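(* Let $\varphi\in\mathcal S(\mathbb C^+;\mathcal U,\mathcal Y)$ and let $\mathcal H_c$ be the reproducing kernel Hilbert space of $\mathcal U$-valued functions on $\mathbb C^+$ with reproducing kernel $K_c(\mu,\lambda)=\frac{1-\varphi(\overline\mu)^*\varphi(\overline\lambda)}{\mu+\overline\lambda}$. There exists a system node $S_c=\begin{bmatrix}A\&B\\ C\&D\end{bmatrix}_c:\begin{bmatrix}\mathcal H_c\\ \mathcal U\end{bmatrix}\supset\mathrm{dom}(S_c)\to\begin{bmatrix}\mathcal H_c\\ \mathcal Y\end{bmatrix}$ that for arbitrary $\begin{bmatrix}x\\ u\end{bmatrix}$ in its domain and $\lambda\in\mathbb C^+$ satisfies $$S_c\begin{bmatrix}x\\ u\end{bmatrix}=\begin{bmatrix}\mu\mapsto-\mu x(\mu)-\varphi(\overline\mu)^*\gamma_\lambda+\big(1-\varphi(\overline\mu)^*\varphi(\overline\lambda)\big)u\\ \gamma_\lambda+\varphi(\overline\lambda)u\end{bmatrix},\quad\mu\in\mathbb C^+,$$ where $\gamma_\lambda\in\mathcal Y$ is uniquely determined by $\lambda$ and $\begin{bmatrix}x\\ u\end{bmatrix}$. Moreover, $S_c$ has the following properties: 1. $S_c$ is a controllable energy-preserving system node. 2. $S_c$ is a realization of $\varphi$. 3. If $S=\begin{bmatrix}A\&B\\ C\&D\end{bmatrix}:\begin{bmatrix}\mathcal X\\ \mathcal U\end{bmatrix}\supset\mathrm{dom}(S)\to\begin{bmatrix}\mathcal X\\ \mathcal Y\end{bmatrix}$ is another operator with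 properties 1 and 2 (with the Hilbert space $\mathcal X$ in place of $\mathcal H_c$), then there is a unitary operator $\Delta:\mathcal H_c\to\mathcal X$ such that $\begin{bmatrix}\Delta&0\\ 0&1_{\mathcal U}\end{bmatrix}$ maps $\mathrm{dom}(S_c)$ one-to-one onto $\mathrm{dom}(S)$ and $$\begin{bmatrix}\Delta&0\\ 0&1_{\mathcal Y}\end{bmatrix}S_c=S\begin{bmatrix}\Delta&0\\ 0&1_{\mathcal U}\end{bmatrix}.$$
   Context: $\mathbb C^+=\{\lambda\in\mathbb C:\mathrm{Re}\,\lambda>0\}$; $\mathcal U,\mathcal Y$ are separable Hilbert spaces; $\mathcal S(\mathbb C^+;\mathcal U,\mathcal Y)$ (Schur class) is the set of holomorphic functions $\mathbb C^+\to\mathcal B(\mathcal U,\mathcal Y)$ whose values are contractions. $\begin{bmatrix}\mathcal X\\ \mathcal U\end{bmatrix}$ is the orthogonal direct sum. The kernel $K_c$ is positive, so $\mathcal H_c$ exists: it contains $K_c(\cdot,\lambda)u$ for $\lambda\in\mathbb C^+$, $u\in\mathcal U$, and $\langle f,K_c(\cdot,\lambda)u\rangle_{\mathcal H_c}=\langle f(\lambda),u\rangle_{\mathcal U}$ for $f\in\mathcal H_c$. Rigged spaces. If $A$ generates a $C_0$-semigroup on a Hilbert space $\mathcal X$, fix $\beta$ in the resolvent set $\mathrm{res}(A)$. Let $\mathcal X_1=\mathrm{dom}(A)$ with norm $\|(\beta-A)x\|_{\mathcal X}$, and let $\mathcal X_{-1}$ be the completion of $\mathcal X$ in the norm $\|(\beta-A)^{-1}x\|_{\mathcal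 X}$ (different $\beta$ give equivalent norms). $A|_{\mathcal X}:\mathcal X\to\mathcal X_{-1}$ is the unique continuous extension of $A$; $\mathrm{res}(A|_{\mathcal X})=\mathrm{res}(A)$. System node. A linear operator $S=\begin{bmatrix}A\&B\\ C\&D\end{bmatrix}:\begin{bmatrix}\mathcal X\\ \mathcal U\end{bmatrix}\supset\mathrm{dom}(S)\to\begin{bmatrix}\mathcal X\\ \mathcal Y\end{bmatrix}$ (with component rows $[A\&B]$ and $[C\&D]$) is a system node on $(\mathcal U,\mathcal X,\mathcal Y)$ if: (i) $S$ is closed; (ii) $Ax:=[A\&B]\begin{bmatrix}x\\ 0\end{bmatrix}$ with $\mathrm{dom}(A)=\{x\in\mathcal X:\begin{bmatrix}x\\ 0\end{bmatrix}\in\mathrm{dom}(S)\}$ generates a $C_0$-semigroup on $\mathcal X$; (iii) $[A\&B]$ extends to a continuous operator $[A|_{\mathcal X}\ \ B]:\begin{bmatrix}\mathcal X\\ \mathcal U\end{bmatrix}\to\mathcal X_{-1}$; (iv) $\mathrm{dom}(S)=\{\begin{bmatrix}x\\ u\end{bmatrix}:A|_{\mathcal X}x+Bu\in\mathcal X\}$. $A$ and $B$ are the main and control operators, and the transfer function is $\widehat{\mathfrak D}(\mu)=[C\&D]\begin{bmatrix}(\mu-A|_{\mathcal X})^{-1}B\\ 1\end{bmatrix}$, $\mu\in\mathrm{res}(A)$. $S$ is a realization of $\varphi$ if its transfer function coincides with $\varphi$ on some right half-plane $\{\mathrm{Re}\,\mu>\omega\}\subset\mathrm{res}(A)\cap\mathrm{dom}(\varphi)$,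 $\omega\in\mathbb R$. A system node $S$ is energy preserving if $\langle z,x\rangle_{\mathcal X}+\langle x,z\rangle_{\mathcal X}=\|u\|^2_{\mathcal U}-\|y\|^2_{\mathcal Y}$ for all $\begin{bmatrix}x\\ u\end{bmatrix}\in\mathrm{dom}(S)$, $\begin{bmatrix}z\\ y\end{bmatrix}=S\begin{bmatrix}x\\ u\end{bmatrix}$. Let $\rho_\infty(A)$ be the component of $\mathrm{res}(A)$ containing some right half-plane; $S$ is controllable if $\mathrm{span}\{(\mu-A|_{\mathcal X})^{-1}Bu:\mu\in\rho_\infty(A),u\in\mathcal U\}$ is dense in $\mathcal X$. *)

(* Defs.v *)
From HB Require Import structures.
From mathcomp Require Import all_boot all_order all_algebra sesquilinear complex.
From mathcomp Require Import all_classical all_reals all_analysis.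

Set Implicit Arguments.
Unset Strict Implicit.
Unset Printing Implicit Defensive.

Import Order.TTheory GRing.Theory Num.Theory.
Import numFieldNormedType.Exports.

Local Open Scope classical_set_scope.
Local Open Scope ring_scope.

(* The complex field is R[i] for R : realType. Norms of R[i]-normed modules
   take their values in R[i]. Inner products are linear in the first
   argument. *)

HB.mixin Record NormedModule_isHilbert (R : realType) V
    of NormedModule R[i] V := {
  hdot : {dot V for Num.conj} ;
  hdot_norm : forall x : V, hdot x x = `|x| ^+ 2
}.

#[short(type="hilbertType")]
HB.structure Definition Hilbert (R : realType) :=
  {V of CompleteNormedModule R[i] V & NormedModule_isHilbert R V}.

Notation "''[' u , v ]" := (hdot u v) : ring_scope.

Definition separable (T : topologicalType) : Prop :=
  exists D : set T, countable D /\ dense D.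

Definition lin_span (K : pzRingType) (V : lmodType K) (G : set V) : set V :=
  [set x | exists n (c : 'I_n -> K) (g : 'I_n -> V),
     (forall i, G (g i)) /\ x = \sum_(i < n) c i *: g i].

(* Unbounded linear operators: the values of [op_fun] off [op_dom] are
   irrelevant. *)
Record linop (K : pzRingType) (E F : lmodType K) := Linop {
  op_dom : set E ;
  op_fun :> E -> F ;
  op_dom0 : op_dom 0 ;
  op_domP : forall (a : K) x y,
    op_dom x -> op_dom y -> op_dom (a *: x + y) ;
  op_linear : forall (a : K) x y,
    op_dom x -> op_dom y -> op_fun (a *: x + y) = a *: op_fun x + op_fun y
}.

Section Semigroups.
Variables (R : realType) (X : hilbertType R).
Implicit Types (T : R -> {linear X -> X}) (A : linop X X).

(* Only the values of [T] on nonnegative times matter. *)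
Definition c0_semigroup T : Prop :=
  [/\ forall t, 0 <= t -> continuous (T t),
      forall x, T 0 x = x,
      forall s t x, 0 <= s -> 0 <= t -> T (s + t) x = T s (T t x)
    & forall x, T t x @[t --> 0^'+] --> x].

Definition is_generator A T : Prop := forall x z,
  (op_dom A x /\ A x = z) <-> ((h^-1)%:C%C *: (T h x - x)) @[h --> 0^'+] --> z.

Definition generates_c0 A : Prop :=
  exists T, c0_semigroup T /\ is_generator A T.

Definition res A : set R[i]^o :=
  [set mu | exists Q : {linear X -> X},
    [/\ continuous Q,
        forall x, op_dom A (Q x) /\ mu *: Q x - A (Q x) = x
      & forall x, op_dom A x -> Q (mu *: x - A x) = x]].

(* (mu - A)^-1 x, meaningful for mu in the resolvent set *)
Definition resolvent A (mu : R[i]) (x : X) : X :=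
  get [set z | op_dom A z /\ mu *: z - A z = x].

Definition rhp (omega : R) : set R[i]^o := [set mu | omega < complex.Re mu].

Definition rho_infty A : set R[i]^o :=
  [set mu | exists omega : R, rhp omega `<=` connected_component (res A) mu].

(* [rig_space] is the space X_{-1}, with X embedded by [rig_emb], and
   [rig_ext] is the extension A|_X of A. *)
Record rigging A := Rigging {
  rig_beta : R[i] ;
  rig_beta_res : res A rig_beta ;
  rig_space :> completeNormedModType R[i] ;
  rig_emb : {linear X -> rig_space} ;
  rig_emb_norm : forall x : X,
    (`|rig_emb x| : R[i]) = `|resolvent A rig_beta x| ;
  rig_emb_dense : dense (range rig_emb) ;
  rig_ext : {linear X -> rig_space} ;
  rig_ext_continuous : continuous rig_ext ;
  rig_extE : forall x, op_dom A x -> rig_ext x = rig_emb (A x)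
}.

(* (mu - A|_X)^-1 v as an element of X, for v in X_{-1} *)
Definition ext_resolvent A (W : rigging A) (mu : R[i]) (v : W) : X :=
  get [set x | mu *: rig_emb W x - rig_ext W x = v].

End Semigroups.

Section MainOperator.
Variables (R : realType) (U X Y : hilbertType R).
Variable S : linop (X * U)%type (X * Y)%type.

Let main_dom : set X := [set x | op_dom S (x, 0)].
Let main_fun (x : X) : X := (S (x, 0)).1.

Let pairE (a : R[i]) (x y : X) :
  (a *: x + y, 0 : U) = a *: (x, 0 : U) + (y, 0 : U).
Proof. by congr (_, _); rewrite /= scaler0 addr0. Qed.

Let main_dom0 : main_dom 0. Proof. exact: op_dom0. Qed.

Let main_domP (a : R[i]) x y :
  main_dom x -> main_dom y -> main_dom (a *: x + y).
Proof. by move=> dx dy; rewrite /main_dom/= pairE; apply: op_domP. Qed.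

Let main_linear (a : R[i]) x y : main_dom x -> main_dom y ->
  main_fun (a *: x + y) = a *: main_fun x + main_fun y.
Proof. by move=> dx dy; rewrite /main_fun pairE op_linear. Qed.

Definition main_op : linop X X :=
  @Linop _ X X main_dom main_fun main_dom0 main_domP main_linear.

End MainOperator.

Section SystemNodes.
Variables (R : realType) (U X Y : hilbertType R).
Implicit Type S : linop (X * U)%type (X * Y)%type.

Definition closed_op S : Prop :=
  closed [set p : (X * U) * (X * Y) | op_dom S p.1 /\ S p.1 = p.2].

Record system_node S := SystemNode {
  sn_closed : closed_op S ;
  sn_generates : generates_c0 (main_op S) ;
  sn_rig :> rigging (main_op S) ;
  sn_control : {linear U -> sn_rig} ;
  sn_control_continuous : continuous sn_control ;
  sn_extends : forall x u, op_dom S (x, u) ->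
    rig_emb sn_rig (S (x, u)).1 = rig_ext sn_rig x + sn_control u ;
  sn_domE : forall x u, op_dom S (x, u) <->
    range (rig_emb sn_rig) (rig_ext sn_rig x + sn_control u)
}.

(* (mu - A|_X)^-1 B u *)
Definition input_state S (N : system_node S) (mu : R[i]) (u : U) : X :=
  ext_resolvent mu (sn_control N u).

Definition transfer S (N : system_node S) (mu : R[i]) (u : U) : Y :=
  (S (input_state N mu u, u)).2.

Definition energy_preserving S : Prop := forall x u, op_dom S (x, u) ->
  '[(S (x, u)).1, x] + '[x, (S (x, u)).1] =
    `|u| ^+ 2 - `|(S (x, u)).2| ^+ 2.

Definition controllable S (N : system_node S) : Prop :=
  dense (lin_span [set x : X | exists mu u,
    rho_infty (main_op S) mu /\ x = input_state N mu u]).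

(* [rhp 0] is the domain of [phi]. *)
Definition realizes S (N : system_node S) (phi : R[i] -> U -> Y) : Prop :=
  exists omega : R,
    rhp omega `<=` res (main_op S) `&` rhp 0 /\
    forall mu u, rhp omega mu -> transfer N mu u = phi mu u.

End SystemNodes.

Section Schur.
Variables (R : realType) (U Y : hilbertType R).

(* Complex differentiability at [lambda] in the operator norm of B(U, Y). *)
Definition op_differentiable (phi : R[i] -> {linear U -> Y}) (lambda : R[i]) :=
  exists D : {linear U -> Y}, continuous D /\
    forall e : R, 0 < e -> \forall h \near (0 : R[i]^o)^', forall u : U,
      (`|h^-1 *: (phi (lambda + h) u - phi lambda u) - D u| : R[i])
        <= e%:C%C * `|u|.

(* Functions on the right half-plane are represented by functions on R[i]
   whose values elsewhere are irrelevant. *)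
Definition schur (phi : R[i] -> {linear U -> Y}) : Prop :=
  forall lambda, rhp 0 lambda ->
    (forall u : U, (`|phi lambda u| : R[i]) <= `|u|) /\
    op_differentiable phi lambda.

Definition adjoint (T : U -> Y) (y : Y) : U :=
  get [set u : U | forall v, '[v, u] = '[T v, y]].

Definition Kc (phi : R[i] -> {linear U -> Y}) (mu lambda : R[i]) (u : U) : U :=
  (mu + lambda^*)^-1 *: (u - adjoint (phi mu^*) (phi lambda^* u)).

(* A Hilbert space whose elements are (via [rk_eval]) U-valued functions on
   the right half-plane, with reproducing kernel [K]. *)
Record rkhs (K : R[i] -> R[i] -> U -> U) := Rkhs {
  rk_space :> hilbertType R ;
  rk_eval : rk_space -> R[i] -> U ;
  rk_eval_linear : forall mu, rhp 0 mu ->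
    linear (fun f : rk_space => rk_eval f mu) ;
  rk_eval_inj : forall f g : rk_space,
    (forall mu, rhp 0 mu -> rk_eval f mu = rk_eval g mu) -> f = g ;
  rk_kernel : forall lambda u, rhp 0 lambda -> exists k : rk_space,
    (forall mu, rhp 0 mu -> rk_eval k mu = K mu lambda u) /\
    (forall f : rk_space, '[f, k] = '[rk_eval f lambda, u])
}.

End Schur.

Definition unitary (R : realType) (H X : hilbertType R)
    (D : {linear H -> X}) : Prop :=
  (forall f g : H, '[D f, D g] = '[f, g]) /\ range D = [set: X].

(* Main.v *)
Require Import Defs.
From HB Require Import structures.
From mathcomp Require Import all_boot all_order all_algebra sesquilinear complex.
From mathcomp Require Import all_classical all_reals all_analysis.
From mathcomp Require Import ring lra.

(** The proof rests on the polarised energy balance. Write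
    [x_al u = (al - A)^-1 B u] for the states of a system node. Since
    [S (x_al u, u) = (al x_al u, D(al) u)] with [D] the transfer function, an
    energy-preserving node satisfies
      [(al + conj be) <x_al u, x_be v> = <u, v> - <D(al) u, D(be) v>],
    and when [D] is [phi] the kernel functions [K_al u = Kc(., conj al) u] of
    [Hc] satisfy the same identity. The states of any energy-preserving
    realization of [phi] thus have the inner products of these functions.

    Existence. The operator [Sc] is the one whose graph is the closed span of the
    vectors [((K_al u, u), (al K_al u, phi al u))]. The identity above is the
    energy balance on generators, and it passes to the closed span
    ([graph_energy]). Testing it against the generators shows that the graph is
    single valued ([graph_single]) and gives the formula for [Sc]
    ([canon_formula]): the vector [gamma] at [lambda] is the output minus
    [phi (conj lambda) u]. The main operator is dissipative, and [al - A] is onto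
    for every [al] in the half-plane ([canon_range]), so it generates a
    contraction semigroup ([m_dissipative_generates]); the semigroup is the limit
    of implicit Euler schemes with halved steps. As [be - A|_X] is an isometry of
    the state space onto the rigged space, the latter is modelled on [Hc] itself
    ([node_from_states]). The states are then the kernel functions, so that
    controllability and the realization property can be read off.

    Uniqueness. The states of a controllable node over a right half-plane are
    total ([states_total]), because their closed span is invariant under the
    resolvents, first in the half-plane and then, by connectedness, in the whole
    component of the resolvent set. Two controllable energy-preserving
    realizations therefore have total families of states with the same Gram
    matrix, hence a unitary operator matching them ([isometric_extension]). It
    intertwines resolvents and outputs, which determine the nodes
    ([nodes_similar]). *)

Set Implicit Arguments.
Unset Strict Implicit.
Unset Printing Implicit Defensive.

Import Order.TTheory GRing.Theory Num.Theory.
Import numFieldNormedType.Exports.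

Local Open Scope classical_set_scope.
Local Open Scope ring_scope.

(** * Real-valued norms and their topology *)

Section RealNorms.
Variable R : realType.
Implicit Types (a b z : R[i]) (V W : normedModType R[i]).

(** Norms over [R[i]] are complex numbers; their real parts carry the same
    information and bring every estimate into the ordered field [R]. *)
Definition cabs z : R := complex.Re `|z|.
Definition nrm V (x : V) : R := complex.Re `|x|.

Lemma ge0_ReK z : 0 <= z -> (complex.Re z)%:C%C = z.
Proof. by move=> /ger0_real /RRe_real. Qed.

Lemma cabsE z : (cabs z)%:C%C = `|z|.
Proof. exact: ge0_ReK. Qed.

Lemma nrmE V (x : V) : (nrm x)%:C%C = `|x|.
Proof. exact: ge0_ReK. Qed.

Lemma nrm_ge0 V (x : V) : 0 <= nrm x.
Proof. by rewrite -ler0c nrmE. Qed.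

Lemma cabs_ge0 z : 0 <= cabs z.
Proof. by rewrite -ler0c cabsE. Qed.

Lemma nrm0 V : nrm (0 : V) = 0.
Proof. by rewrite /nrm normr0. Qed.

Lemma nrm_eq0 V (x : V) : nrm x = 0 -> x = 0.
Proof. by move=> h; apply/normr0_eq0; rewrite -nrmE h. Qed.

Lemma nrm_gt0 V (x : V) : x != 0 -> 0 < nrm x.
Proof.
move=> x0; rewrite lt_neqAle nrm_ge0 andbT eq_sym.
by apply: contra_neq x0; exact: nrm_eq0.
Qed.

Lemma nrmD V (x y : V) : nrm (x + y) <= nrm x + nrm y.
Proof. by rewrite -lecR rmorphD /= !nrmE ler_normD. Qed.

Lemma nrmN V (x : V) : nrm (- x) = nrm x.
Proof. by rewrite /nrm normrN. Qed.

Lemma nrmB V (x y : V) : nrm (x - y) = nrm (y - x).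
Proof. by rewrite -nrmN opprB. Qed.

Lemma nrmZ V a (x : V) : nrm (a *: x) = cabs a * nrm x.
Proof. by apply: complexI; rewrite rmorphM /= !nrmE cabsE normrZ. Qed.

Lemma nrm_tri V (y x z : V) : nrm (x - z) <= nrm (x - y) + nrm (y - z).
Proof. by rewrite -(subrKA y x (- z)); exact: nrmD. Qed.

Lemma cabsM a b : cabs (a * b) = cabs a * cabs b.
Proof. by apply: complexI; rewrite rmorphM /= !cabsE normrM. Qed.

Lemma cabsD a b : cabs (a + b) <= cabs a + cabs b.
Proof. by rewrite -lecR rmorphD /= !cabsE ler_normD. Qed.

Lemma cabsN a : cabs (- a) = cabs a.
Proof. by rewrite /cabs normrN. Qed.

Lemma cabs_eq0 z : cabs z = 0 -> z = 0.
Proof. by move=> h; apply/normr0_eq0; rewrite -cabsE h. Qed.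

Lemma cabs_real (r : R) : cabs r%:C%C = `|r|.
Proof. by rewrite /cabs normc_def /= expr0n /= addr0 sqrtr_sqr. Qed.

Lemma Re_le_cabs z : `|complex.Re z| <= cabs z.
Proof. by rewrite -lecR cabsE normc_ge_Re. Qed.

Lemma conjCE z : z^* = (complex.Re z -i* complex.Im z)%C.
Proof. by case: z. Qed.

Lemma Re_conj z : complex.Re z^* = complex.Re z.
Proof. by rewrite conjCE. Qed.

Lemma Re_realM (r : R) z : complex.Re (r%:C%C * z) = r * complex.Re z.
Proof. by case: z => a b /=; rewrite mul0r subr0. Qed.

Lemma nrm_lt V (x : V) (e : R) : (`|x| < e%:C%C) = (nrm x < e).
Proof. by rewrite -nrmE ltcR. Qed.

Lemma pos_real z : 0 < z -> exists2 e : R, 0 < e & z = e%:C%C.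
Proof.
by move=> z0; exists (complex.Re z); rewrite -?ltcR ge0_ReK // ltW.
Qed.

Lemma nbhs_nrmP V (x : V) (P : set V) :
  nbhs x P <-> exists2 e : R, 0 < e & forall y, nrm (x - y) < e -> P y.
Proof.
split=> [/nbhs_ballP[e e0 h]|[e e0 h]].
  have [r r0 er] := pos_real e0; exists r => // y; rewrite -nrm_lt => hy.
  by apply: h; rewrite -ball_normE /= er.
apply/nbhs_ballP; exists e%:C%C; first by rewrite /= ltcR.
by move=> y; rewrite -ball_normE /= nrm_lt; exact: h.
Qed.

Lemma closed_approxP V (M : set V) : closed M <->
  forall x, (forall e : R, 0 < e -> exists2 y, M y & nrm (x - y) < e) -> M x.
Proof.
split=> [cM x h|h x hx].
  apply: cM => P /nbhs_nrmP[e e0 eP]; have [y My ye] := h _ e0.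
  by exists y; split => //; exact: eP.
apply: h => e e0; have [] := hx [set y | nrm (x - y) < e].
  by apply/nbhs_nrmP; exists e.
by move=> y [My ye]; exists y.
Qed.

Lemma dense_approxP V (M : set V) : dense M <->
  forall x (e : R), 0 < e -> exists2 y, M y & nrm (x - y) < e.
Proof.
split=> [dM x e e0|h O [x Ox] oO].
  have [||y [ye My]] := dM [set y | nrm (x - y) < e].
  - by exists x; rewrite /= subrr nrm0.
  - rewrite openE => y /= ye; apply/nbhs_nrmP.
    exists (e - nrm (x - y)); first by rewrite subr_gt0.
    by move=> z /= yz; have := nrm_tri y x z; lra.
  by exists y.
have /nbhs_nrmP[e e0 eO] : nbhs x O by exact: open_nbhs_nbhs.
by have [y My ye] := h x e e0; exists y; split => //; exact: eO.
Qed.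

(** A neighbourhood of [0] is mapped into the unit ball, so by homogeneity a
    continuous operator is bounded. *)
Lemma linear_bound V W (T : {linear V -> W}) : continuous T ->
  exists2 k : R, 0 < k & forall x, nrm (T x) <= k * nrm x.
Proof.
move=> cT.
have /nbhs_nrmP[d d0 dT] : nbhs (0 : V) [set x | nrm (T x) < 1].
  have /(cT 0) : nbhs (T 0) [set y : W | nrm y < 1].
    by apply/nbhs_nrmP; exists 1 => // y; rewrite raddf0 sub0r nrmN.
  by [].
exists (2 / d); first by rewrite divr_gt0.
move=> x; have [->|x0] := eqVneq x 0; first by rewrite raddf0 !nrm0 mulr0.
have nx := nrm_gt0 x0.
pose r := d / (2 * nrm x).
have r0 : 0 < r by rewrite divr_gt0 // mulr_gt0.
have rx : r * nrm x = d / 2 by rewrite /r; field; rewrite gt_eqF.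
have : nrm (T (r%:C%C *: x)) < 1.
  apply: dT; rewrite sub0r nrmN nrmZ cabs_real gtr0_norm // rx.
  by lra.
rewrite linearZ nrmZ cabs_real gtr0_norm // => h.
rewrite -(ler_pM2l r0) mulrCA rx; apply: ltW; apply: (lt_le_trans h).
by rewrite le_eqVlt; apply/orP; left; apply/eqP; field; rewrite gt_eqF.
Qed.

Lemma bound_continuous V W (T : {linear V -> W}) (k : R) :
  (forall x, nrm (T x) <= k * nrm x) -> continuous T.
Proof.
move=> kT x P /nbhs_nrmP[e e0 eP]; apply/nbhs_nrmP.
exists (e / (`|k| + 1)); first by rewrite divr_gt0 // ltr_wpDl.
move=> y yx; apply: eP; rewrite -raddfB.
have k0 : 0 < `|k| + 1 by rewrite ltr_wpDl.
apply: (le_lt_trans (kT _)).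
move: yx; rewrite ltr_pdivlMr //; apply: le_lt_trans.
rewrite mulrC ler_wpM2l ?nrm_ge0 //.
by rewrite (le_trans (ler_norm k)) // lerDl.
Qed.

(** Sequences suffice in normed spaces; completeness as a predicate also
    covers product spaces. *)
Definition nrm_cvg V (u : nat -> V) (l : V) := forall e : R, 0 < e ->
  exists N, forall n, (N <= n)%N -> nrm (u n - l) < e.

Definition nrm_cauchy V (u : nat -> V) := forall e : R, 0 < e ->
  exists N, forall n m, (N <= n)%N -> (N <= m)%N -> nrm (u n - u m) < e.

Definition nrm_complete V := forall u : nat -> V, nrm_cauchy u ->
  exists l, nrm_cvg u l.

Lemma complete_nrm_complete (V : completeNormedModType R[i]) : nrm_complete V.
Proof.
move=> u cu.
have /cauchy_cvgP : cauchy (u @ \oo).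
  apply: cauchy_exP => e e0; have [r r0 er] := pos_real e0.
  have [N hN] := cu _ r0; exists (u N); exists N => // n /= Nn.
  by rewrite -ball_normE /= er nrm_lt; exact: hN.
move=> /cvgrPdist_lt h; exists (lim (u @ \oo)) => e e0.
have [|N _ hN] := h e%:C%C; first by rewrite ltcR.
by exists N => n Nn; rewrite nrmB -nrm_lt; exact: hN.
Qed.

Lemma nrm_pair_le V W (p : V * W) (e : R) :
  (nrm p <= e) = (nrm p.1 <= e) && (nrm p.2 <= e).
Proof.
rewrite -!lecR !nrmE {1}/Num.norm /= comparable_ge_max //.
by rewrite real_comparable // normr_real.
Qed.

Lemma nrm_pair_lt V W (p : V * W) (e : R) :
  (nrm p < e) = (nrm p.1 < e) && (nrm p.2 < e).
Proof.
rewrite -!ltcR !nrmE {1}/Num.norm /= comparable_gt_max //.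
by rewrite real_comparable // normr_real.
Qed.

Lemma nrm_fst V W (p : V * W) : nrm p.1 <= nrm p.
Proof. by have := lexx (nrm p); rewrite nrm_pair_le => /andP[]. Qed.

Lemma nrm_snd V W (p : V * W) : nrm p.2 <= nrm p.
Proof. by have := lexx (nrm p); rewrite nrm_pair_le => /andP[]. Qed.

Lemma nrm_complete_prod V W :
  nrm_complete V -> nrm_complete W -> nrm_complete (V * W)%type.
Proof.
move=> cV cW u cu.
have [e|l1 h1] := cV (fun n => (u n).1).
  move=> /cu[N hN]; exists N => n m Nn Nm.
  by apply: le_lt_trans (hN n m Nn Nm); exact: (nrm_fst (u n - u m)).
have [e|l2 h2] := cW (fun n => (u n).2).
  move=> /cu[N hN]; exists N => n m Nn Nm.
  by apply: le_lt_trans (hN n m Nn Nm); exact: (nrm_snd (u n - u m)).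
exists (l1, l2) => e e0; have [N1 k1] := h1 _ e0; have [N2 k2] := h2 _ e0.
exists (maxn N1 N2) => n; rewrite geq_max => /andP[n1 n2].
by rewrite nrm_pair_lt /= k1 // k2.
Qed.

Lemma closed_lip V W (f : V -> W) (k : R) (M : set W) : closed M ->
  (forall x y, nrm (f x - f y) <= k * nrm (x - y)) -> closed [set x | M (f x)].
Proof.
move=> /closed_approxP cM fk; apply/closed_approxP => x h; apply: cM => e e0.
have k1 : 0 < `|k| + 1 by rewrite ltr_wpDl.
have [|y My xy] := h (e / (`|k| + 1)); first by rewrite divr_gt0.
exists (f y) => //; apply: (le_lt_trans (fk _ _)).
move: xy; rewrite ltr_pdivlMr //; apply: le_lt_trans.
rewrite mulrC ler_wpM2l ?nrm_ge0 //.
by rewrite (le_trans (ler_norm k)) // lerDl.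
Qed.

Lemma closed_zero V : closed [set 0 : V].
Proof.
apply/closed_approxP => y hy; apply/nrm_eq0/le_anti.
rewrite nrm_ge0 andbT; apply/ler_addgt0Pr => e e0; rewrite add0r.
by have [_ -> ] := hy _ e0; rewrite subr0 => /ltW.
Qed.

Lemma inv_small (e : R) : 0 < e ->
  exists N, forall n, (N <= n)%N -> n.+1%:R^-1 < e.
Proof.
move=> e0; have [N _ hN] : \forall n \near \oo, n.+1%:R^-1 < e.
  by near=> n; near: n; exact: near_infty_natSinv_lt (PosNum e0).
by exists N.
Unshelve. all: by end_near. Qed.

Lemma closed_seq V (M : set V) (u : nat -> V) l : closed M ->
  (forall n, M (u n)) -> nrm_cvg u l -> M l.
Proof.
move=> /closed_approxP cM Mu ul; apply: cM => e /ul[N hN].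
by exists (u N) => //; rewrite nrmB; exact: hN.
Qed.

(** A closed relation that controls its second component by the first one has
    a closed domain: preimages of a convergent sequence are Cauchy. This yields
    at once closed ranges of dissipative operators and the extension of
    isometries from dense subspaces. *)
Lemma graph_domain_closed V W (P : set (V * W)) (k : R) :
  nrm_complete W -> closed P ->
  (forall x y x' y', P (x, y) -> P (x', y') -> nrm (y - y') <= k * nrm (x - x')) ->
  closed [set x | exists y, P (x, y)].
Proof.
move=> cW cP hk; apply/closed_approxP => x h.
have /choice[u hu] n : exists p : V * W,
    P p /\ nrm (x - p.1) < n.+1%:R^-1.
  have [|y [z Pyz] yx] := h n.+1%:R^-1; first by rewrite invr_gt0.
  by exists (y, z).
have ucvg : nrm_cvg (fun n => (u n).1) x.
  move=> e e0; have [N hN] := inv_small e0; exists N => n Nn.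
  by rewrite nrmB; have [_ /lt_trans] := hu n; apply; exact: hN.
have k1 : 0 < `|k| + 1 by rewrite ltr_wpDl.
have [e e0|l hl] := cW (fun n => (u n).2).
  have [|N hN] := ucvg (e / (`|k| + 1) / 2); first by rewrite !divr_gt0.
  exists N => n m Nn Nm.
  have [] := (hu n, hu m); case: (u n) (hN n Nn) => xn yn /= h1.
  case: (u m) (hN m Nm) => xm ym /= h2 [Pn _] [Pm _].
  apply: (le_lt_trans (hk _ _ _ _ Pn Pm)).
  have : nrm (xn - xm) < e / (`|k| + 1).
    have := nrm_tri x xn xm; rewrite (nrmB x xm) => h3.
    by rewrite (le_lt_trans h3) // [ltRHS]splitr ltrD.
  rewrite ltr_pdivlMr //; apply: le_lt_trans.
  rewrite mulrC ler_wpM2l ?nrm_ge0 //.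
  by rewrite (le_trans (ler_norm k)) // lerDl.
exists l; apply: (closed_seq (u := u)) => // [n|e e0]; first by have [] := hu n.
have [N1 k1'] := ucvg _ e0; have [N2 k2] := hl _ e0.
exists (maxn N1 N2) => n; rewrite geq_max => /andP[n1 n2].
by rewrite nrm_pair_lt /= k1' // k2.
Qed.

Lemma le_eps (x y : R) : (forall e : R, 0 < e -> x <= y + e) -> x <= y.
Proof. by move=> h; apply/ler_addgt0Pr. Qed.

End RealNorms.

(** * Inner products and closed subspaces *)

Section InnerProduct.
Variables (R : realType) (V : hilbertType R).
Implicit Types (x y z f : V) (a : R[i]).

Lemma dotDl x y f : '[x + y, f] = '[x, f] + '[y, f].
Proof. exact: linearDl. Qed.
Lemma dotNl x f : '[- x, f] = - '[x, f].
Proof. exact: linearNl. Qed.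
Lemma dotZl a x f : '[a *: x, f] = a * '[x, f].
Proof. exact: linearZl_LR. Qed.
Lemma dot0l f : '[0, f] = 0.
Proof. exact: linear0l. Qed.
Lemma dotC x y : '[x, y] = '[y, x]^*.
Proof. by rewrite hermC expr0 mul1r. Qed.
Lemma dotDr f x y : '[f, x + y] = '[f, x] + '[f, y].
Proof. exact: linearDr. Qed.
Lemma dotNr f x : '[f, - x] = - '[f, x].
Proof. exact: linearNr. Qed.
Lemma dotZr f a x : '[f, a *: x] = a^* * '[f, x].
Proof. exact: linearZr_LR. Qed.
Lemma dot0r f : '[f, 0] = 0.
Proof. exact: linear0r. Qed.

Definition dotE := (dotDl, dotNl, dotZl, dotDr, dotNr, dotZr, dot0l, dot0r).

Definition rdot x y : R := complex.Re '[x, y].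

Lemma dotxx x : '[x, x] = (nrm x ^+ 2)%:C%C.
Proof. by rewrite hdot_norm -nrmE rmorphXn. Qed.

Lemma rdotxx x : rdot x x = nrm x ^+ 2.
Proof. by rewrite /rdot dotxx. Qed.

Lemma rdotC x y : rdot x y = rdot y x.
Proof. by rewrite /rdot dotC Re_conj. Qed.

Lemma rdotDl x y f : rdot (x + y) f = rdot x f + rdot y f.
Proof. by rewrite /rdot dotDl raddfD. Qed.
Lemma rdotDr f x y : rdot f (x + y) = rdot f x + rdot f y.
Proof. by rewrite /rdot dotDr raddfD. Qed.
Lemma rdotNl x f : rdot (- x) f = - rdot x f.
Proof. by rewrite /rdot dotNl raddfN. Qed.
Lemma rdotNr f x : rdot f (- x) = - rdot f x.
Proof. by rewrite /rdot dotNr raddfN. Qed.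
Lemma rdotZl (r : R) x f : rdot (r%:C%C *: x) f = r * rdot x f.
Proof. by rewrite /rdot dotZl Re_realM. Qed.
Lemma rdotZr (r : R) x f : rdot f (r%:C%C *: x) = r * rdot f x.
Proof. by rewrite rdotC rdotZl rdotC. Qed.

Definition rdotE := (rdotDl, rdotNl, rdotZl, rdotDr, rdotNr, rdotZr).

Lemma dot_ext x y : (forall f, '[x, f] = '[y, f]) -> x = y.
Proof.
move=> h; apply/subr0_eq/nrm_eq0/eqP; rewrite -sqrf_eq0 -rdotxx /rdot.
by rewrite dotDl dotNl h subrr.
Qed.

Lemma nrm_sqD x y : nrm (x + y) ^+ 2 = nrm x ^+ 2 + 2 * rdot x y + nrm y ^+ 2.
Proof. by rewrite -!rdotxx !rdotE (rdotC y x); ring. Qed.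

(** Nonnegativity of the squared norm of [|y|^2 x - <x, y> y]. *)
Lemma cauchy_schwarz x y : cabs '[x, y] <= nrm x * nrm y.
Proof.
have [->|y0] := eqVneq y 0; first by rewrite dot0r nrm0 mulr0 /cabs normr0.
have ny := nrm_gt0 y0.
have : 0 <= nrm ((nrm y ^+ 2)%:C%C *: x - '[x, y] *: y) ^+ 2 by exact: sqr_ge0.
rewrite -rdotxx /rdot !dotE !dotxx (dotC y x) /=.
have hz (z : R[i]) (p q : R) : complex.Re
    (p%:C%C * (p%:C%C^* * q%:C%C - z^* * z)
     - z * (p%:C%C^* * z^* - z^* * p%:C%C)) = p * (p * q - cabs z ^+ 2).
  have -> : cabs z ^+ 2 = complex.Re z ^+ 2 + complex.Im z ^+ 2.
    by rewrite /cabs normc_def sqr_sqrtr // addr_ge0 // sqr_ge0.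
  by case: z => a b; rewrite !conjCE /=; ring.
rewrite hz.
rewrite pmulr_rge0 ?exprn_gt0 // -exprMn subr_ge0 mulrC.
by rewrite ler_pXn2r ?nnegrE ?cabs_ge0 ?mulr_ge0 ?nrm_ge0.
Qed.

Lemma rdot_le x y : rdot x y <= nrm x * nrm y.
Proof.
by rewrite (le_trans (ler_norm _)) // (le_trans (Re_le_cabs _)) // cauchy_schwarz.
Qed.

(** Continuity of the inner product: its values pass to limits. *)
Lemma dot_approx x f (c : R[i]) :
  (forall e : R, 0 < e -> exists2 y, '[y, f] = c & nrm (x - y) < e) ->
  '[x, f] = c.
Proof.
move=> h; apply/subr0_eq/cabs_eq0/le_anti; rewrite cabs_ge0 andbT.
apply: le_eps => e e0.
have f1 : 0 < nrm f + 1 by rewrite ltr_wpDl // nrm_ge0.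
have [|y <- xy] := h (e / (nrm f + 1)); first by rewrite divr_gt0.
rewrite -dotNl -dotDl add0r (le_trans (cauchy_schwarz _ _)) //.
move: xy; rewrite ltr_pdivlMr // => /ltW; apply: le_trans.
by rewrite ler_wpM2l ?nrm_ge0 // lerDl.
Qed.

End InnerProduct.

(** Vector identities reduce to ring identities by pairing both sides with an
    arbitrary vector. *)
Ltac vring := apply: dot_ext => ?; rewrite ?dotE; ring.

Section Subspaces.
Variable R : realType.
Implicit Type V : normedModType R[i].

Definition subspace V (M : set V) :=
  M 0 /\ forall a x y, M x -> M y -> M (a *: x + y).

(** Defined as an intersection, so that every property that cuts out a closed
    subspace passes from [G] to its closed span by instantiation. *)
Definition closed_span V (G : set V) : set V :=
  [set x | forall M, subspace M -> closed M -> G `<=` M -> M x].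

Section Theory.
Variables (V : normedModType R[i]) (M : set V) (sM : subspace M).

Lemma subspace0 : M 0. Proof. by case: sM. Qed.
Lemma subspaceP a x y : M x -> M y -> M (a *: x + y).
Proof. by case: sM => _; exact. Qed.
Lemma subspaceZ a x : M x -> M (a *: x).
Proof. by move=> Mx; rewrite -[_ *: _]addr0; apply: subspaceP => //; exact: subspace0. Qed.
Lemma subspaceD x y : M x -> M y -> M (x + y).
Proof. by move=> Mx My; rewrite -[x]scale1r; exact: subspaceP. Qed.
Lemma subspaceN x : M x -> M (- x).
Proof. by rewrite -scaleN1r; exact: subspaceZ. Qed.
Lemma subspaceB x y : M x -> M y -> M (x - y).
Proof. by move=> Mx My; apply: subspaceD => //; exact: subspaceN. Qed.
End Theory.

Lemma closed_span_subspace V (G : set V) : subspace (closed_span G).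
Proof.
split=> [M sM _ _|a x y hx hy M sM cM GM]; first exact: subspace0.
by apply: subspaceP => //; [exact: hx|exact: hy].
Qed.

Lemma closed_span_closed V (G : set V) : closed (closed_span G).
Proof.
apply/closed_approxP => x h M sM cM GM.
by move/closed_approxP: (cM); apply => e /h[y hy]; exists y => //; exact: hy.
Qed.

Lemma sub_closed_span V (G : set V) : G `<=` closed_span G.
Proof. by move=> x Gx M _ _; exact. Qed.

Lemma lin_span_sub V (G M : set V) : subspace M -> G `<=` M -> lin_span G `<=` M.
Proof.
move=> sM GM x [n [c [g [Gg ->]]]].
apply: (big_ind M); first exact: subspace0.
  by move=> ? ?; exact: subspaceD.
by move=> i _; apply: subspaceZ => //; exact/GM/Gg.
Qed.

Lemma lin_span_dense_sub V (G M : set V) : dense (lin_span G) ->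
  subspace M -> closed M -> G `<=` M -> forall x, M x.
Proof.
move=> /dense_approxP dG sM /closed_approxP cM GM x; apply: cM => e /(dG x)[y Gy ?].
by exists y => //; exact: lin_span_sub Gy.
Qed.

End Subspaces.

(** * Projection theorem, Riesz representation, adjoints *)

Section Projection.
Variables (R : realType) (V : hilbertType R).
Implicit Types (x y w : V).

Lemma parallelogram x y :
  nrm (x + y) ^+ 2 + nrm (x - y) ^+ 2 = 2 * nrm x ^+ 2 + 2 * nrm y ^+ 2.
Proof. by rewrite !nrm_sqD nrmN rdotNr; ring. Qed.

(** By the parallelogram identity a norm-minimising sequence in a closed,
    midpoint-convex set is Cauchy. *)
Lemma min_norm (C : set V) : C !=set0 -> closed C ->
  (forall x y, C x -> C y -> C ((2^-1)%:C%C *: (x + y))) ->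
  exists2 w, C w & forall x, C x -> nrm w <= nrm x.
Proof.
move=> [c0 Cc0] cC midC; pose D := [set nrm x | x in C]; pose d := inf D.
have hD : has_inf D.
  by split; [exists (nrm c0), c0|exists 0 => _ [x _ <-]; exact: nrm_ge0].
have d0 : 0 <= d.
  by apply: lb_le_inf; [case: hD|move=> _ [x _ <-]; exact: nrm_ge0].
have dC x : C x -> d <= nrm x.
  by move=> Cx; apply: ge_inf; [case: hD|exists x].
have /choice[u hu] n : exists x, C x /\ nrm x < d + n.+1%:R^-1.
  have [|_ [x Cx <-] xd] := @inf_adherent _ D n.+1%:R^-1 _ hD.
    by rewrite invr_gt0.
  by exists x.
have key x y (r : R) : 0 < r -> r <= 1 -> C x -> C y -> nrm x < d + r ->
    nrm y < d + r -> nrm (x - y) ^+ 2 < (8 * d + 8) * r.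
  move=> r0 r1 Cx Cy xd yd; have := parallelogram x y.
  have := dC _ (midC _ _ Cx Cy); rewrite nrmZ cabs_real ger0_norm // => hxy.
  have sq (z : V) : nrm z < d + r -> nrm z ^+ 2 < (d + r) ^+ 2.
    by move=> zd; rewrite ltr_pXn2r ?nnegrE ?nrm_ge0 //; lra.
  have hs : (2 * d) ^+ 2 <= nrm (x + y) ^+ 2.
    by rewrite ler_pXn2r ?nnegrE ?nrm_ge0 //; lra.
  have hr : r ^+ 2 <= r by rewrite expr2 ger_pMl.
  by have := sq x xd; have := sq y yd; nra.
have [e e0|w uw] := @complete_nrm_complete _ V u.
  (* this r makes the bound of [key] at most the square of e *)
  pose r := Num.min 1 (e ^+ 2 / (8 * d + 8)).
  have d8 : 0 < 8 * d + 8 by lra.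
  have r0 : 0 < r by rewrite lt_min ltr01 divr_gt0 // exprn_gt0.
  have [N hN] := inv_small r0; exists N => n m /hN Nn /hN Nm.
  have [[Cn un] [Cm um]] := (hu n, hu m).
  rewrite -(@ltr_pXn2r _ 2) ?nnegrE ?nrm_ge0 // ?ltW //.
  apply: (@lt_le_trans _ _ ((8 * d + 8) * r)).
    apply: key => //; first by rewrite ge_min lexx.
      by rewrite (lt_trans un) // ltrD2l.
    by rewrite (lt_trans um) // ltrD2l.
  by rewrite mulrC -ler_pdivlMr // ge_min lexx orbT.
exists w; first by apply: closed_seq uw => // n; have [] := hu n.
move=> x Cx; apply: (le_trans _ (dC x Cx)); apply: le_eps => e e0.
have e20 : 0 < e / 2 by lra.
have [N hN] := uw _ e20; have [N' hN'] := inv_small e20.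
have := hN (maxn N N') (leq_maxl _ _); have := hN' (maxn N N') (leq_maxr _ _).
have [_] := hu (maxn N N'); set v := u _; have := nrmD (w - v) v.
rewrite subrK (nrmB w v); move: (_.+1%:R^-1) => q; lra.
Qed.

(** If [<w, m>] were nonzero, moving [w] slightly along [m] would shorten it. *)
Lemma min_norm_orth (M : set V) w : subspace M ->
  (forall m, M m -> nrm w <= nrm (w + m)) -> forall m, M m -> '[w, m] = 0.
Proof.
move=> sM wm.
have key m : M m -> rdot w m = 0.
  move=> Mm; set r := rdot w m; pose k := nrm m ^+ 2 + 1.
  have k0 : 0 < k by rewrite /k ltr_wpDl // sqr_ge0.
  have := wm _ (subspaceZ sM (- (r / k))%:C%C Mm).
  rewrite -(@ler_pXn2r _ 2) ?nnegrE ?nrm_ge0 // nrm_sqD rdotZr nrmZ cabs_real.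
  rewrite exprMn real_normK ?num_real // -/r.
  have -> : nrm m ^+ 2 = k - 1 by rewrite /k; ring.
  have -> : nrm w ^+ 2 + 2 * (- (r / k) * r) + (- (r / k)) ^+ 2 * (k - 1) =
    nrm w ^+ 2 - r ^+ 2 * ((k + 1) / k ^+ 2) by field; rewrite gt_eqF.
  rewrite lerBrDr gerDl pmulr_lle0; last by rewrite divr_gt0 ?exprn_gt0 //; lra.
  by move=> h; apply/eqP; rewrite -sqrf_eq0 eq_le h sqr_ge0.
move=> m Mm; have := key _ (subspaceZ sM '[w, m] Mm).
rewrite /rdot dotZr; case: '[w, m] => a b /=.
rewrite mulNr opprK => h; have [-> ->] // : a = 0 /\ b = 0.
by split; nra.
Qed.

(** The shortest vector of the coset [x0 + M] is orthogonal to [M]. *)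
Lemma exists_orthogonal (M : set V) x0 : subspace M -> closed M -> ~ M x0 ->
  exists2 w, w != 0 & forall m, M m -> '[w, m] = 0.
Proof.
move=> sM cM Mx0; pose C := [set x | M (x - x0)].
have cC : closed C.
  by apply: (@closed_lip _ _ _ (fun x => x - x0) 1) => // x y; rewrite mul1r opprB subrKA.
have [||w Cw wmin] := @min_norm C _ cC.
- by exists x0; rewrite /C /= subrr; exact: subspace0.
- move=> x y Cx Cy; rewrite /C /=.
  have -> : (2^-1)%:C%C *: (x + y) - x0 =
    (2^-1)%:C%C *: (x - x0) + (2^-1)%:C%C *: (y - x0).
    rewrite -scalerDr addrACA -opprD scalerBr; congr (_ - _).
    rewrite scalerDr -scalerDl -rmorphD.
    have -> : 2^-1 + 2^-1 = 1 :> R by field.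
    exact: esym (scale1r _).
  by apply: subspaceD => //; apply: subspaceZ.
exists w.
  apply/eqP => w0; apply: Mx0.
  by move: Cw; rewrite /C /= w0 sub0r => /(subspaceN sM); rewrite opprK.
apply: min_norm_orth => // m Mm; apply: wmin; rewrite /C /=.
by rewrite addrAC; exact: subspaceD.
Qed.

Lemma closed_subspace_full (M : set V) : subspace M -> closed M ->
  (forall w, (forall m, M m -> '[m, w] = 0) -> w = 0) -> forall x, M x.
Proof.
move=> sM cM h x; apply: contrapT => /(exists_orthogonal sM cM)[w /eqP w0 wM].
by apply/w0/h => m Mm; rewrite dotC wM // rmorph0.
Qed.

Lemma subspace_dense (M : set V) : subspace M ->
  (forall w, (forall m, M m -> '[m, w] = 0) -> w = 0) -> dense M.
Proof.
move=> sM h; apply/dense_approxP => x e e0.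
pose C := [set y | forall r : R, 0 < r -> exists2 z, M z & nrm (y - z) < r].
suff /(_ x): forall y, C y by apply.
apply: closed_subspace_full.
- split=> [r r0|a y z Cy Cz r r0].
    by exists 0; [exact: subspace0|rewrite subrr nrm0].
  pose k := cabs a + 1; have k0 : 0 < k by rewrite ltr_wpDl ?cabs_ge0.
  have [|y' My hy] := Cy (r / k / 2); first by rewrite !divr_gt0.
  have [|z' Mz hz] := Cz (r / 2); first by rewrite divr_gt0.
  exists (a *: y' + z'); first exact: subspaceP.
  rewrite opprD addrACA -scalerBr (le_lt_trans (nrmD _ _)) // nrmZ [ltRHS]splitr.
  rewrite ler_ltD //; apply: (@le_trans _ _ (k * nrm (y - y'))).
    by rewrite ler_wpM2r ?nrm_ge0 // lerDl.
  by rewrite mulrC -ler_pdivlMr // mulrAC ltW.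
- apply/closed_approxP => y hy r r0; have [|z Cz yz] := hy (r / 2).
    by rewrite divr_gt0.
  have [|t Mt zt] := Cz (r / 2); first by rewrite divr_gt0.
  by exists t => //; rewrite (le_lt_trans (nrm_tri z _ _)) // [ltRHS]splitr ltrD.
- move=> w hw; apply: h => m Mm; apply: hw => r r0; exists m => //.
  by rewrite subrr nrm0.
Qed.

Lemma lin_span_subspace (G : set V) : subspace (lin_span G).
Proof.
split.
  exists 0%N, (fun=> 0), (fun=> 0); split; first by case.
  by rewrite big_ord0.
move=> a x y [n [c [g [Gg ->]]]] [m [c' [g' [Gg' ->]]]].
exists (n + m)%N, (fun i : 'I_(n + m) => match fintype.split i with inl j => a * c j | inr j => c' j end),
  (fun i : 'I_(n + m) => match fintype.split i with inl j => g j | inr j => g' j end); split.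
  by move=> i; case: (fintype.split i).
rewrite big_split_ord scaler_sumr /=; congr (_ + _); apply: eq_bigr => i _.
  have -> : fintype.split (lshift m i) = inl i by exact: (unsplitK (inl i)).
  by rewrite scalerA.
by rewrite (_ : fintype.split (rshift n i) = inr i) //; exact: (unsplitK (inr i)).
Qed.

Lemma lin_span_dense (G : set V) :
  (forall w, (forall g, G g -> '[g, w] = 0) -> w = 0) -> dense (lin_span G).
Proof.
move=> h; apply: subspace_dense; first exact: lin_span_subspace.
move=> w hw; apply: h => g Gg; apply: hw.
exists 1%N, (fun=> 1), (fun=> g); split => //.
by rewrite big_ord1 scale1r.
Qed.

(** The representing vector is a multiple of a vector orthogonal to the
    kernel of [l]. *)
Lemma riesz (l : V -> R[i]) (k : R) :
  (forall a x y, l (a *: x + y) = a * l x + l y) ->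
  (forall x, cabs (l x) <= k * nrm x) -> exists u, forall v, '[v, u] = l v.
Proof.
move=> lin lk.
have l0 : l 0 = 0.
  by have := lin (-1) 0 0; rewrite scaler0 addr0 mulN1r addNr.
have lZ a x : l (a *: x) = a * l x by rewrite -[a *: x]addr0 lin l0 addr0.
have lB x y : l (x - y) = l x - l y.
  by rewrite addrC -scaleN1r lin mulN1r addrC.
have sK : subspace [set x | l x = 0].
  by split=> // a x y /= hx hy; rewrite lin hx hy mulr0 addr0.
have cK : closed [set x | l x = 0].
  apply/closed_approxP => x h /=; apply: cabs_eq0; apply/le_anti.
  rewrite cabs_ge0 andbT; apply: le_eps => e e0; rewrite add0r.
  have k1 : 0 < `|k| + 1 by rewrite ltr_wpDl.
  have [|y /= ly xy] := h (e / (`|k| + 1)); first by rewrite divr_gt0.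
  rewrite -[l x]subr0 -ly -lB (le_trans (lk _)) //.
  move: xy; rewrite ltr_pdivlMr // => /ltW; apply: le_trans.
  rewrite mulrC ler_wpM2l ?nrm_ge0 //.
  by rewrite (le_trans (ler_norm k)) // lerDl.
have [h|] := pselect (forall v, l v = 0).
  by exists 0 => v; rewrite dot0r h.
move=> /existsNP[x0 /(exists_orthogonal sK cK)[w w0 wK]].
have nw : '[w, w] != 0.
  by apply: contra_neq w0 => h; apply: nrm_eq0; apply/eqP; rewrite -sqrf_eq0 -rdotxx /rdot h.
exists ((l w / '[w, w])^* *: w) => v; rewrite dotZr conjCK.
have : '[w, l v *: w - l w *: v] = 0 by apply: wK; rewrite /= lB !lZ mulrC subrr.
move=> /(congr1 Num.conj); rewrite -dotC rmorph0 !dotE => /subr0_eq h.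
by rewrite mulrAC -h mulfK.
Qed.

End Projection.

Lemma adjointP (R : realType) (U Y : hilbertType R) (T : {linear U -> Y}) y :
  (forall u, nrm (T u) <= nrm u) -> forall v, '[v, adjoint T y] = '[T v, y].
Proof.
move=> hT; suff : exists u, forall v, '[v, u] = '[T v, y].
  by move=> h; exact: (getPex h).
apply: (@riesz _ _ (fun v => '[T v, y]) (nrm y)) => [a x z|x].
  by rewrite linearP dotDl dotZl.
by rewrite mulrC (le_trans (cauchy_schwarz _ _)) // ler_wpM2r ?nrm_ge0.
Qed.

(** * Generation by m-dissipative operators *)

Section Linop.
Variables (R : realType) (E F : lmodType R[i]) (A : linop E F).

Lemma linop_domP a x y : op_dom A x -> op_dom A y -> op_dom A (a *: x + y).
Proof. exact: op_domP. Qed.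
Lemma linop_domZ a x : op_dom A x -> op_dom A (a *: x).
Proof. by move=> dx; rewrite -[_ *: _]addr0; apply: op_domP => //; exact: op_dom0. Qed.
Lemma linop_domD x y : op_dom A x -> op_dom A y -> op_dom A (x + y).
Proof. by rewrite -{2}[x]scale1r; exact: op_domP. Qed.
Lemma linop_domN x : op_dom A x -> op_dom A (- x).
Proof. by rewrite -scaleN1r; exact: linop_domZ. Qed.
Lemma linop_domB x y : op_dom A x -> op_dom A y -> op_dom A (x - y).
Proof. by move=> dx dy; apply: linop_domD => //; exact: linop_domN. Qed.

Lemma linop0 : A 0 = 0.
Proof.
have := op_linear (-1) (op_dom0 A) (op_dom0 A).
by rewrite scaler0 addr0 scaleN1r addNr.
Qed.
Lemma linopZ a x : op_dom A x -> A (a *: x) = a *: A x.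
Proof.
move=> dx; have := op_linear a dx (op_dom0 A).
by rewrite addr0 linop0 addr0.
Qed.
Lemma linopD x y : op_dom A x -> op_dom A y -> A (x + y) = A x + A y.
Proof. by move=> dx dy; have := op_linear 1 dx dy; rewrite !scale1r. Qed.
Lemma linopN x : op_dom A x -> A (- x) = - A x.
Proof. by move=> dx; rewrite -scaleN1r linopZ // scaleN1r. Qed.
Lemma linopB x y : op_dom A x -> op_dom A y -> A (x - y) = A x - A y.
Proof. by move=> dx dy; rewrite linopD ?linopN //; exact: linop_domN. Qed.

Lemma linear_exists (f : E -> F) : linear f -> exists g : {linear E -> F}, g =1 f.
Proof.
move=> lf; pose L := GRing.isLinear.Build _ _ _ _ f lf.
pose g : {linear E -> F} := HB.pack f L.
by exists g.
Qed.

End Linop.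

Section HilleYosida.
Variables (R : realType) (X : hilbertType R) (A : linop X X).
Hypothesis dissipative : forall x, op_dom A x -> rdot (A x) x <= 0.
Hypothesis range_full : forall (h : R) y, 0 < h ->
  exists x, op_dom A x /\ x - h%:C%C *: A x = y.
Implicit Types (x y w : X) (s t h : R).

Lemma resolvent_expand h x : 0 <= h -> op_dom A x -> nrm x <= nrm (x - h%:C%C *: A x).
Proof.
move=> h0 dx; rewrite -(@ler_pXn2r _ 2) ?nnegrE ?nrm_ge0 //.
rewrite nrm_sqD rdotNr rdotZr rdotC nrmN.
by have := dissipative dx; have := sqr_ge0 (nrm (h%:C%C *: A x)); nra.
Qed.

(** The implicit Euler step [(1 - h A)^-1], with [step 0] the identity. *)
Definition step h y : X :=
  if 0 < h then get [set x | op_dom A x /\ x - h%:C%C *: A x = y] else y.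

Lemma stepP h y : 0 < h -> op_dom A (step h y) /\ step h y - h%:C%C *: A (step h y) = y.
Proof. by move=> h0; rewrite /step h0; exact: getPex (range_full y h0). Qed.

Lemma step0 x : step 0 x = x.
Proof. by rewrite /step ltxx. Qed.

Lemma step_unique h x : 0 < h -> op_dom A x -> step h (x - h%:C%C *: A x) = x.
Proof.
move=> h0 dx; have [dJ eJ] := stepP (x - h%:C%C *: A x) h0.
apply/subr0_eq/nrm_eq0/le_anti; rewrite nrm_ge0 andbT.
rewrite (le_trans (resolvent_expand (ltW h0) (linop_domB dJ dx))) //.
by rewrite linopB // scalerBr opprD opprK addrACA eJ [- x + _]addrC -opprB addNr nrm0.
Qed.

Lemma step_linear h : linear (step h).
Proof.
move=> a x y; have [h0|h0] := boolP (0 < h); last by rewrite /step (negbTE h0).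
have [dx ex] := stepP x h0; have [dy ey] := stepP y h0.
rewrite -{1}ex -{1}ey -[in RHS](step_unique h0 (linop_domP a dx dy)).
congr step; rewrite op_linear // !scalerDr !scalerN !scalerA (mulrC a) opprD.
by rewrite addrACA.
Qed.

Lemma stepB h x y : step h (x - y) = step h x - step h y.
Proof. by rewrite addrC -scaleN1r step_linear scaleN1r addrC. Qed.

Lemma step_contr h x : nrm (step h x) <= nrm x.
Proof.
have [h0|h0] := boolP (0 < h); last by rewrite /step (negbTE h0).
have [dx {2}<-] := stepP x h0; exact: resolvent_expand (ltW h0) dx.
Qed.

Lemma step_lip h x y : nrm (step h x - step h y) <= nrm (x - y).
Proof. by rewrite -stepB step_contr. Qed.

Lemma step_commA h x : op_dom A x -> op_dom A (step h x) /\ A (step h x) = step h (A x).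
Proof.
move=> dx; have [h0|h0] := boolP (0 < h); last by rewrite /step (negbTE h0).
have [dJ eJ] := stepP x h0; split=> //.
have hC : h%:C%C != 0 :> R[i] by rewrite (inj_eq (@complexI R)) gt_eqF.
have dA : op_dom A (A (step h x)).
  have -> : A (step h x) = h%:C%C^-1 *: (step h x - x).
    by rewrite -{3}eJ opprB addrC subrK scalerA mulVf // scale1r.
  exact/linop_domZ/linop_domB.
rewrite -{2}eJ linopB // ?linopZ ?step_unique //.
exact: linop_domZ.
Qed.

Definition dom_sq x w := [/\ op_dom A x, op_dom A (A x) & A (A x) = w].

Lemma step_dom_sq h x w : dom_sq x w -> dom_sq (step h x) (step h w).
Proof.
move=> [dx dAx <-]; have [dJ eJ] := step_commA h dx.
by have [dJA eJA] := step_commA h dAx; split; rewrite ?eJ.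
Qed.

(** Since [(1 - aA)(1 - bA) = 1 - (a + b)A + ab A^2], two Euler steps differ
    from the single step of the same total length only by [ab A^2] applied
    between contractions. All convergence rates below come from this. *)
Lemma step_mul a b x w : 0 <= a -> 0 <= b -> dom_sq x w ->
  nrm (step a (step b x) - step (a + b) x) <= a * b * nrm w.
Proof.
rewrite le_eqVlt => /orP[/eqP<-|a0].
  by move=> *; rewrite step0 add0r subrr nrm0 !mul0r.
rewrite le_eqVlt => /orP[/eqP<-|b0].
  by move=> *; rewrite step0 addr0 subrr nrm0 mulr0 mul0r.
move=> hx; have ab0 := addr_gt0 a0 b0.
have [_ eb] := stepP x b0; have [_ ea] := stepP (step b x) a0.
have [dp dAp eAp] := step_dom_sq a (step_dom_sq b hx).
set p := step a (step b x) in ea dp dAp eAp *.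
have ep : p - (a + b)%:C%C *: A p = x - (a * b)%:C%C *: A (A p).
  rewrite -eb -ea linopB // ?linopZ //; last exact: linop_domZ.
  by vring.
rewrite -(step_unique ab0 dp) ep stepB addrAC subrr add0r nrmN (le_trans (step_contr _ _)) //.
have ab : 0 <= a * b by rewrite ltW // mulr_gt0.
rewrite nrmZ cabs_real ger0_norm // ler_wpM2l // eAp.
by rewrite (le_trans (step_contr _ _)) // step_contr.
Qed.

Lemma step_comm a b x : step a (step b x) = step b (step a x).
Proof.
have [b0|b0] := boolP (0 < b); last by rewrite /step (negbTE b0).
have [db eb] := stepP x b0.
rewrite -{2}eb stepB; have [dab eab] := step_commA a db.
have -> : step a (b%:C%C *: A (step b x)) = b%:C%C *: step a (A (step b x)).
  have := step_linear a b%:C%C (A (step b x)) 0; rewrite !addr0 => ->.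
  by have := stepB a 0 0; rewrite !subr0 subrr => ->; rewrite addr0.
by rewrite -eab step_unique.
Qed.

Lemma iter_diff (P Q : X -> X) (I : X -> Prop) (e : R) n x :
  (forall x y, nrm (P x - P y) <= nrm (x - y)) ->
  (forall x, I x -> I (Q x)) -> (forall x, I x -> nrm (P x - Q x) <= e) ->
  I x -> nrm (iter n P x - iter n Q x) <= n%:R * e.
Proof.
move=> Plip QI PQ Ix.
elim: n => [|n IHn]; first by rewrite subrr nrm0 mul0r.
have Iq : I (iter n Q x) by elim: n {IHn} => //= n /QI.
rewrite !iterS (le_trans (nrm_tri (P (iter n Q x)) _ _)) //.
rewrite -natr1 mulrDl mul1r lerD // ?PQ //.
exact: le_trans (Plip _ _) IHn.
Qed.

(** Step sizes are halved, so that consecutive approximations are compared by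
    splitting each step in two. *)
Definition euler n t x := iter (2 ^ n) (step (t / (2 ^ n)%:R)) x.

Lemma iter_lip n h x y : nrm (iter n (step h) x - iter n (step h) y) <= nrm (x - y).
Proof. by elim: n => //= n; apply: le_trans; exact: step_lip. Qed.

Lemma euler_lip n t x y : nrm (euler n t x - euler n t y) <= nrm (x - y).
Proof. exact: iter_lip. Qed.

Lemma euler_linear n t : linear (euler n t).
Proof. by rewrite /euler; move: (t / _) => h a x y; elim: (2 ^ n)%N => //= m ->; rewrite step_linear. Qed.

Lemma euler0 n x : euler n 0 x = x.
Proof. by rewrite /euler mul0r; elim: (2 ^ n)%N => //= m ->; rewrite step0. Qed.

Lemma exp2_gt0 n : 0 < (2 ^ n)%:R :> R.
Proof. by rewrite ltr0n expn_gt0. Qed.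

Lemma euler_succ n t x w : 0 <= t -> dom_sq x w ->
  nrm (euler n.+1 t x - euler n t x) <= t ^+ 2 / 4 * nrm w / (2 ^ n)%:R.
Proof.
move=> t0 hx; rewrite /euler expnSr iterM /=.
set h := t / _; set g := t / (2 ^ n)%:R.
have n0 := exp2_gt0 n.
have gh : g = h + h.
  by rewrite /g /h natrM; field; rewrite gt_eqF.
have h0 : 0 <= h by rewrite divr_ge0 // ltW // ltr0n muln_gt0 expn_gt0.
rewrite gh; pose I x' := exists2 w', dom_sq x' w' & nrm w' <= nrm w.
have -> : t ^+ 2 / 4 * nrm w / (2 ^ n)%:R = (2 ^ n)%:R * (h * h * nrm w).
  by rewrite /h natrM; field; rewrite gt_eqF.
apply: (@iter_diff _ _ I).
- by move=> y z; rewrite (le_trans (step_lip _ _ _)) // step_lip.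
- move=> y [w' hy lw]; exists (step (h + h) w'); first exact: step_dom_sq.
  by rewrite (le_trans (step_contr _ _)).
- move=> y [w' hy lw]; rewrite (le_trans (step_mul h0 h0 hy)) //.
  by rewrite ler_wpM2l // mulr_ge0.
- by exists w.
Qed.

Lemma euler_diff n k t x w : 0 <= t -> dom_sq x w ->
  nrm (euler (n + k) t x - euler n t x) <=
    t ^+ 2 / 2 * nrm w * ((2 ^ n)%:R^-1 - (2 ^ (n + k))%:R^-1).
Proof.
move=> t0 hx; elim: k => [|k IHk]; first by rewrite addn0 !subrr nrm0 mulr0.
rewrite addnS (le_trans (nrm_tri (euler (n + k) t x) _ _)) //.
rewrite (le_trans (lerD (euler_succ (n + k) t0 hx) IHk)) // le_eqVlt.
apply/orP; left; apply/eqP; rewrite expnS natrM.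
have n0 := exp2_gt0 n; have nk0 := exp2_gt0 (n + k).
by field; rewrite !gt_eqF.
Qed.

(** If [w] is orthogonal to the domain and [v = (1 - A)^-1 w], then
    [0 = <v, w> = |v|^2 - <v, A v>], whose real part is at least [|v|^2]. *)
Lemma dom_dense : dense (op_dom A).
Proof.
apply: subspace_dense.
  by split=> [|a x y]; [exact: op_dom0|exact: op_domP].
move=> w hw; have [dv ev] := stepP w ltr01; have v0 : step 1 w = 0.
  have := congr1 (@complex.Re R) (hw _ dv); rewrite -/(rdot _ _) -{2}ev.
  rewrite rdotDr rdotxx rdotNr rdotZr mul1r rdotC /= => h.
  have := dissipative dv; have := sqr_ge0 (nrm (step 1 w)) => h1 h2.
  by apply: nrm_eq0; apply/eqP; rewrite -sqrf_eq0; apply/eqP; lra.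
by rewrite -ev v0 linop0 scaler0 subrr.
Qed.

(** The domain of the square is a core: approximate [(1 - A) x] by a vector of
    the domain and apply [(1 - A)^-1]. *)
Lemma graph_approx x (e : R) : op_dom A x -> 0 < e ->
  exists x' w, [/\ dom_sq x' w, nrm (x - x') < e & nrm (A x - A x') < e].
Proof.
move=> dx e0; pose y := x - A x.
have e2 : 0 < e / 2 by lra.
have [y' dy yy] := (dense_approxP _).1 dom_dense y _ e2.
have [dx' ex'] := stepP y' ltr01; rewrite scale1r in ex'.
have dAx' : op_dom A (A (step 1 y')).
  have -> : A (step 1 y') = step 1 y' - y' by rewrite -{3}ex' opprB addrC subrK.
  exact: linop_domB.
exists (step 1 y'), (A (A (step 1 y'))).
have xJ : x = step 1 y by rewrite /y -[A x]scale1r step_unique.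
have h1 : nrm (x - step 1 y') < e / 2.
  by rewrite {1}xJ (le_lt_trans (step_lip _ _ _)).
split=> //; first by rewrite (lt_le_trans h1) //; lra.
have -> : A x - A (step 1 y') = (x - step 1 y') - (y - y').
  by rewrite /y -{3}ex'; vring.
have := nrmD (x - step 1 y') (- (y - y')); rewrite (nrmN (y - y')).
by move=> h; rewrite (le_lt_trans h) // [ltRHS]splitr ltrD.
Qed.

End HilleYosida.

Section Limits.
Variables (R : realType) (V : normedModType R[i]).
Implicit Types (u v : nat -> V) (l : V).

Lemma nrm_cvg_unique u l l' : nrm_cvg u l -> nrm_cvg u l' -> l = l'.
Proof.
move=> ul ul'; apply/subr0_eq/nrm_eq0/le_anti; rewrite nrm_ge0 andbT.
apply: le_eps => e e0; rewrite add0r.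
have e2 : 0 < e / 2 by lra.
have [N hN] := ul _ e2; have [N' hN'] := ul' _ e2.
have := hN (maxn N N') (leq_maxl _ _); have := hN' (maxn N N') (leq_maxr _ _).
have := nrm_tri (u (maxn N N')) l l'; rewrite (nrmB l (u _)).
by move: (nrm _) (nrm _) (nrm _) => a b c; lra.
Qed.

Lemma nrm_cvg_linear u v l l' a : nrm_cvg u l -> nrm_cvg v l' ->
  nrm_cvg (fun n => a *: u n + v n) (a *: l + l').
Proof.
move=> ul vl e e0; pose k := cabs a + 1.
have k0 : 0 < k by rewrite ltr_wpDl ?cabs_ge0.
have [|N hN] := ul (e / k / 2); first by rewrite !divr_gt0.
have [|N' hN'] := vl (e / 2); first by rewrite divr_gt0.
exists (maxn N N') => n; rewrite geq_max => /andP[/hN n1 /hN' n2].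
rewrite opprD addrACA -scalerBr (le_lt_trans (nrmD _ _)) // nrmZ [ltRHS]splitr.
rewrite ler_ltD //; apply: (@le_trans _ _ (k * nrm (u n - l))).
  by rewrite ler_wpM2r ?nrm_ge0 // lerDl.
by rewrite mulrC -ler_pdivlMr // mulrAC ltW.
Qed.

Lemma nrm_cvg_le u l x (c : R) : nrm_cvg u l ->
  (forall n, nrm (u n - x) <= c) -> nrm (l - x) <= c.
Proof.
move=> ul h; apply: le_eps => e /ul[N /(_ N (leqnn N)) hN].
have := nrm_tri (u N) l x; rewrite (nrmB l (u N)); have := h N.
by move: hN; move: (nrm _) (nrm _) (nrm _) => p q r; lra.
Qed.

Lemma nrm_cvg_diff u v l l' : nrm_cvg u l -> nrm_cvg v l' ->
  (forall e : R, 0 < e ->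
    exists N, forall n, (N <= n)%N -> nrm (u n - v n) < e) -> l = l'.
Proof.
move=> ul vl h; apply: (@nrm_cvg_unique u) => // e e0.
have e2 : 0 < e / 2 by lra.
have [N hN] := h _ e2; have [N' hN'] := vl _ e2.
exists (maxn N N') => n; rewrite geq_max => /andP[/hN n1 /hN' n2].
by rewrite (le_lt_trans (nrm_tri (v n) _ _)) // [ltRHS]splitr ltrD.
Qed.

Lemma lip_eq_dense (W : normedModType R[i]) (f g : V -> W) (D : set V) : dense D ->
  (forall x y, nrm (f x - f y) <= nrm (x - y)) ->
  (forall x y, nrm (g x - g y) <= nrm (x - y)) ->
  {in D, f =1 g} -> f =1 g.
Proof.
move=> /dense_approxP dD fl gl fg x.
apply/subr0_eq/nrm_eq0/le_anti; rewrite nrm_ge0 andbT.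
apply: le_eps => e e0; rewrite add0r.
have e2 : 0 < e / 2 by lra.
have [y Dy xy] := dD x _ e2.
have := nrm_tri (f y) (f x) (g x); have := fl x y; have := gl y x.
rewrite (fg y) ?inE // (nrmB y x).
by move: xy; move: (nrm _) (nrm _) (nrm _) (nrm _) => p q r s; lra.
Qed.

Lemma cvg_at_rightP (f : R -> V) (z : V) :
  (f h @[h --> 0^'+] --> z) <-> forall e : R, 0 < e -> exists2 d : R, 0 < d &
    forall h, 0 < h -> h < d -> nrm (f h - z) < e.
Proof.
split=> [/cvgrPdist_lt H e e0|H].
  have [|d /= d0 hd] := H e%:C%C; first by rewrite ltcR.
  exists d => // h h0 hlt; rewrite nrmB -nrm_lt; apply: hd => //=.
  by rewrite sub0r normrN gtr0_norm.
apply/cvgrPdist_lt => e' e'0; have [e e0 ->] := pos_real e'0.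
have [d d0 hd] := H _ e0; exists d => //= h /=.
rewrite sub0r normrN => hlt h0; rewrite nrm_lt nrmB; apply: hd => //.
by rewrite (le_lt_trans (ler_norm h)).
Qed.

End Limits.

Section HilleYosidaGeneration.
Variables (R : realType) (X : hilbertType R) (A : linop X X).
Hypothesis dissipative : forall x, op_dom A x -> rdot (A x) x <= 0.
Hypothesis range_full : forall (h : R) y, 0 < h ->
  exists x, op_dom A x /\ x - h%:C%C *: A x = y.
Implicit Types (x y w : X) (s t h : R).

Let step_lip := step_lip dissipative range_full.
Let euler_lip := euler_lip dissipative range_full.

Lemma dom_sq_dense : dense [set x | exists w, dom_sq A x w].
Proof.
apply/dense_approxP => x e e0; have e2 : 0 < e / 2 by lra.
have [y dy xy] := (dense_approxP _).1 (dom_dense dissipative range_full) x _ e2.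
have [z [w [zw yz _]]] := graph_approx dissipative range_full dy e2.
exists z; first by exists w.
by rewrite (le_lt_trans (nrm_tri y _ _)) // [ltRHS]splitr ltrD.
Qed.

Lemma inv_exp2_small (e : R) : 0 < e -> exists N, forall n, (N <= n)%N ->
  (2 ^ n)%:R^-1 < e.
Proof.
move=> /inv_small[N hN]; exists N => n /hN; apply: le_lt_trans.
by rewrite lef_pV2 ?posrE ?ltr0n ?expn_gt0 // ler_nat ltn_expl.
Qed.

Lemma euler_cauchy t x : 0 <= t -> nrm_cauchy (fun n => euler A n t x).
Proof.
move=> t0 e e0; have e4 : 0 < e / 4 by lra.
have e8 : 0 < e / 8 by lra.
have [y [w hw] xy] := (dense_approxP _).1 dom_sq_dense x _ e8.
pose c := t ^+ 2 / 2 * nrm w + 1.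
have c1 : 0 <= t ^+ 2 / 2 * nrm w by rewrite !mulr_ge0 ?nrm_ge0 ?sqr_ge0.
have c0 : 0 < c by rewrite ltr_wpDl.
have [N hN] := inv_exp2_small (divr_gt0 e4 c0).
have key n : (N <= n)%N -> nrm (euler A n t x - euler A N t x) < e / 2.
  move=> Nn.
  have h1 := euler_lip n t x y; have h2 := euler_lip N t y x.
  have := euler_diff dissipative range_full N (n - N) t0 hw; rewrite subnKC // => h3.
  have h4 : t ^+ 2 / 2 * nrm w * ((2 ^ N)%:R^-1 - (2 ^ n)%:R^-1) < e / 4.
    apply: (@le_lt_trans _ _ (c * (2 ^ N)%:R^-1)).
      apply: ler_pM => //; first by rewrite subr_ge0 lef_pV2 ?posrE ?ltr0n ?expn_gt0 // ler_nat leq_exp2l.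
        by rewrite lerDl.
      by rewrite gerBl invr_ge0.
    by rewrite mulrC -ltr_pdivlMr // hN.
  have := nrm_tri (euler A n t y) (euler A n t x) (euler A N t x).
  have := nrm_tri (euler A N t y) (euler A n t y) (euler A N t x).
  rewrite (nrmB y x) in h2; have h5 := le_lt_trans h3 h4.
  move: h1 h2 h5 xy; clear.
  move: (nrm (x - y)) (nrm (_ - _)) (nrm (_ - _)) (nrm (_ - _)) (nrm (_ - _)) (nrm (_ - _)).
  by move=> *; lra.
exists N => n m /key h1 /key h2.
rewrite (le_lt_trans (nrm_tri (euler A N t x) _ _)) // [ltRHS]splitr ltrD //.
by rewrite nrmB.
Qed.

(** The exponential formula: limit of [(1 - (t / 2^n) A)^(-2^n)]. *)
Definition semigroup t x : X :=
  if 0 <= t then get [set l | nrm_cvg (fun n => euler A n t x) l] else x.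
Local Notation T := semigroup.

Lemma semigroup_cvg t x : 0 <= t -> nrm_cvg (fun n => euler A n t x) (T t x).
Proof.
move=> t0; rewrite /T t0; have := complete_nrm_complete (euler_cauchy x t0).
exact: getPex.
Qed.

Lemma semigroup_linear t : linear (T t).
Proof.
move=> a x y; have [t0|t0] := boolP (0 <= t); last by rewrite /T (negbTE t0).
apply: (nrm_cvg_unique (semigroup_cvg _ t0)).
have := nrm_cvg_linear a (semigroup_cvg x t0) (semigroup_cvg y t0).
congr nrm_cvg; apply/funext => n; exact/esym/euler_linear.
Qed.

Lemma semigroupB t x y : T t (x - y) = T t x - T t y.
Proof. by rewrite addrC -scaleN1r semigroup_linear scaleN1r addrC. Qed.

Lemma semigroup_contr t x : nrm (T t x) <= nrm x.
Proof.
have [t0|t0] := boolP (0 <= t); last by rewrite /T (negbTE t0).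
rewrite -[T t x]subr0; apply: nrm_cvg_le (semigroup_cvg x t0) _ => n.
have [g hg] := linear_exists (euler_linear dissipative range_full n t).
by have := euler_lip n t x 0; rewrite -!hg raddf0 !subr0.
Qed.

Lemma semigroup_lip t x y : nrm (T t x - T t y) <= nrm (x - y).
Proof. by rewrite -semigroupB semigroup_contr. Qed.

Lemma semigroup0 x : T 0 x = x.
Proof.
apply: nrm_cvg_unique (semigroup_cvg x (lexx 0)) _ => e e0.
by exists 0%N => n _; rewrite euler0 subrr nrm0.
Qed.

(** With [2^n] steps on each side, the Euler approximations of [T s (T t x)]
    and [T (s + t) x] differ by [2^n] defects of order [s t / 4^n]. *)
Lemma semigroupD s t x : 0 <= s -> 0 <= t -> T (s + t) x = T s (T t x).
Proof.
move=> s0 t0; have st0 := addr_ge0 s0 t0; move: x.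
apply: (lip_eq_dense dom_sq_dense).
- exact: semigroup_lip.
- by move=> x y; rewrite (le_trans (semigroup_lip _ _ _)) ?semigroup_lip.
move=> x /set_mem[w hw].
apply: (nrm_cvg_diff (semigroup_cvg x st0) (semigroup_cvg (T t x) s0)) => e e0.
have e2 : 0 < e / 2 by lra.
pose c := s * t * nrm w + 1.
have c1 : 0 <= s * t * nrm w by rewrite !mulr_ge0 ?nrm_ge0.
have c0 : 0 < c by rewrite ltr_wpDl.
have [N hN] := semigroup_cvg x t0 e2.
have [N' hN'] := inv_exp2_small (divr_gt0 e2 c0).
exists (maxn N N') => n; rewrite geq_max => /andP[/hN n1 /hN' n2].
rewrite (le_lt_trans (nrm_tri (euler A n s (euler A n t x)) _ _)) //.
rewrite [ltRHS]splitr ltr_leD //; last first.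
  by rewrite (le_trans (euler_lip _ _ _ _)) // ltW.
have n0 := exp2_gt0 R n.
set a := s / (2 ^ n)%:R; set b := t / (2 ^ n)%:R.
have a0 : 0 <= a by rewrite divr_ge0 // ltW.
have b0 : 0 <= b by rewrite divr_ge0 // ltW.
have -> : euler A n (s + t) x = iter (2 ^ n) (step A (a + b)) x.
  by rewrite /euler mulrDl.
have -> : euler A n s (euler A n t x) = iter (2 ^ n) (step A a \o step A b) x.
  rewrite /euler -/a -/b; elim: (2 ^ n)%N => //= m <-.
  congr step; move: (iter m (step A b) x) => z; elim: m => //= m ->.
  exact: step_comm.
rewrite nrmB; apply: (@le_lt_trans _ _ ((2 ^ n)%:R * (a * b * nrm w))).
  apply: (@iter_diff _ _ _ _ (fun y => exists2 w', dom_sq A y w' & nrm w' <= nrm w)).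
  - by move=> y z /=; rewrite (le_trans (step_lip _ _ _)) // step_lip.
  - move=> y [w' hy lw]; exists (step A (a + b) w'); first exact: step_dom_sq.
    by rewrite (le_trans (step_contr dissipative range_full _ _)).
  - move=> y [w' hy lw]; rewrite (le_trans (step_mul dissipative range_full a0 b0 hy)) //.
    by rewrite ler_wpM2l // mulr_ge0.
  - by exists w.
have -> : (2 ^ n)%:R * (a * b * nrm w) = s * t * nrm w / (2 ^ n)%:R.
  by rewrite /a /b; field; rewrite gt_eqF.
apply: (@le_lt_trans _ _ (c * (2 ^ n)%:R^-1)).
  by rewrite ler_wpM2r ?invr_ge0 ?ler0n // lerDl.
by rewrite mulrC -ltr_pdivlMr.
Qed.

(** A single Euler step is accurate to second order, which identifies the
    generator on the domain of the square. *)
Lemma semigroup_step t x w : 0 <= t -> dom_sq A x w ->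
  nrm (T t x - step A t x) <= t ^+ 2 / 2 * nrm w.
Proof.
move=> t0 hw; apply: nrm_cvg_le (semigroup_cvg x t0) _ => n.
have := euler_diff dissipative range_full 0 n t0 hw; rewrite add0n.
rewrite /euler expn0 divr1 /=; move/le_trans; apply.
rewrite invr1 -[leRHS]mulr1 ler_wpM2l ?gerBl ?invr_ge0 //.
by rewrite !mulr_ge0 ?nrm_ge0 ?sqr_ge0.
Qed.

Lemma step_diff h x : 0 <= h -> op_dom A x -> nrm (step A h x - x) <= h * nrm (A x).
Proof.
rewrite le_eqVlt => /orP[/eqP<-|h0] dx; first by rewrite step0 subrr nrm0 mul0r.
have [dJ eJ] := stepP range_full x h0.
have -> : step A h x - x = h%:C%C *: A (step A h x).
  by rewrite -{2}eJ opprB addrC subrK.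
have [_ ->] := step_commA dissipative range_full h dx.
rewrite nrmZ cabs_real gtr0_norm // ler_wpM2l ?(ltW h0) //.
exact: step_contr.
Qed.

Lemma semigroup_dom t x : 0 <= t -> op_dom A x ->
  nrm (T t x - x) <= t * nrm (A x).
Proof.
move=> t0 dx; apply: nrm_cvg_le (semigroup_cvg x t0) _ => n.
have n0 := exp2_gt0 R n.
have h0 : 0 <= t / (2 ^ n)%:R by rewrite divr_ge0 // ltW.
have := @iter_diff _ _ (step A (t / (2 ^ n)%:R)) id (eq^~ x)
  (t / (2 ^ n)%:R * nrm (A x)) (2 ^ n) x (@step_lip _).
rewrite mulrA mulrCA divff ?gt_eqF // mulr1.
have -> : iter (2 ^ n) id x = x by elim: (2 ^ n)%N.
by apply=> // y ->; exact: step_diff.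
Qed.

Lemma semigroup_strong x (e : R) : 0 < e ->
  exists2 d : R, 0 < d & forall h, 0 < h -> h < d -> nrm (T h x - x) < e.
Proof.
move=> e0; have e3 : 0 < e / 3 by lra.
have [y dy xy] := (dense_approxP _).1 (dom_dense dissipative range_full) x _ e3.
have k0 : 0 < nrm (A y) + 1 by rewrite ltr_wpDl ?nrm_ge0.
exists (e / 3 / (nrm (A y) + 1)); first by rewrite !divr_gt0.
move=> h h0; rewrite ltr_pdivlMr // => hd.
have h1 := semigroup_dom (ltW h0) dy.
have h2 := semigroup_lip h x y.
have h3 := nrm_tri (T h y) (T h x) x; have h4 := nrm_tri y (T h y) x.
have h5 : h * nrm (A y) <= h * (nrm (A y) + 1) by rewrite ler_wpM2l ?lerDl ?ltW.
rewrite (nrmB y x) in h4.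
by lra.
Qed.

Lemma quotient_dom_sq h x w : 0 < h -> dom_sq A x w ->
  nrm (h^-1%:C%C *: (T h x - x) - A x) <= 3 / 2 * (h * nrm w).
Proof.
move=> h0 hw; have [dx dAx eA] := hw; have [dJ eJ] := stepP range_full x h0.
have hC : h^-1%:C%C * h%:C%C = 1 :> R[i] by rewrite -rmorphM /= mulVf ?gt_eqF.
have h1 := semigroup_step (ltW h0) hw.
have h2 := step_diff (ltW h0) dAx; rewrite eA in h2.
have [_ e3] := step_commA dissipative range_full h dx.
have -> : h^-1%:C%C *: (T h x - x) - A x =
  h^-1%:C%C *: (T h x - step A h x) + (step A h (A x) - A x).
  rewrite -e3 -{2}eJ -[A (step A h x) in RHS]scale1r -hC; vring.
rewrite (le_trans (nrmD _ _)) // nrmZ cabs_real gtr0_norm ?invr_gt0 //.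
apply: (@le_trans _ _ (h^-1 * (h ^+ 2 / 2 * nrm w) + h * nrm w)).
  by rewrite lerD // ler_wpM2l // invr_ge0 ltW.
by rewrite le_eqVlt; apply/orP; left; apply/eqP; field; rewrite gt_eqF.
Qed.

(** From the domain of the square to the domain: difference quotients are
    bounded by the graph norm, in which [dom_sq] is dense. *)
Lemma quotient_cvg x (e : R) : op_dom A x -> 0 < e ->
  exists2 d : R, 0 < d &
    forall h, 0 < h -> h < d -> nrm (h^-1%:C%C *: (T h x - x) - A x) < e.
Proof.
move=> dx e0; have e4 : 0 < e / 4 by lra.
have [y [w [hw xy Axy]]] := graph_approx dissipative range_full dx e4.
have [dy _ _] := hw.
have k0 : 0 < nrm w + 1 by rewrite ltr_wpDl ?nrm_ge0.
exists (e / 4 / (nrm w + 1)); first by rewrite !divr_gt0.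
move=> h h0; rewrite ltr_pdivlMr // => hd.
have h1 := quotient_dom_sq h0 hw.
have h2 := semigroup_dom (ltW h0) (linop_domB dx dy).
rewrite linopB // semigroupB in h2.
have h3 : nrm (h^-1%:C%C *: (T h x - x) - h^-1%:C%C *: (T h y - y))
    <= nrm (A x - A y).
  have -> : h^-1%:C%C *: (T h x - x) - h^-1%:C%C *: (T h y - y) =
    h^-1%:C%C *: (T h x - T h y - (x - y)) by vring.
  by rewrite nrmZ cabs_real gtr0_norm ?invr_gt0 // mulrC ler_pdivrMr // mulrC.
have h4 := nrm_tri (h^-1%:C%C *: (T h y - y)) (h^-1%:C%C *: (T h x - x)) (A x).
have h5 := nrm_tri (A y) (h^-1%:C%C *: (T h y - y)) (A x).
rewrite (nrmB (A y)) in h5.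
have h6 : h * nrm w <= h * (nrm w + 1) by rewrite ler_wpM2l ?lerDl ?ltW.
by lra.
Qed.

Lemma quotient_dissipative h x : 0 < h ->
  rdot (h^-1%:C%C *: (T h x - x)) x <= 0.
Proof.
move=> h0; rewrite rdotZl pmulr_rle0 ?invr_gt0 // rdotDl rdotNl rdotxx subr_le0.
rewrite (le_trans (rdot_le _ _)) // expr2 ler_wpM2r ?nrm_ge0 //.
exact: semigroup_contr.
Qed.

(** The generator has no vectors outside the domain of [A]: correcting [x] by
    [(1 - A)^-1 (x - z)] leaves a vector [g] whose difference quotients tend
    to [g]; they are dissipative because the semigroup is contractive, so
    [g = 0]. *)
Lemma quotient_dom x z :
  (forall e : R, 0 < e -> exists2 d : R, 0 < d & forall h, 0 < h -> h < d ->
      nrm (h^-1%:C%C *: (T h x - x) - z) < e) ->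
  op_dom A x /\ A x = z.
Proof.
move=> hz; have [dv] := stepP range_full (x - z) ltr01.
set v := step A 1 (x - z) in dv *; rewrite (_ : 1%:C%C = 1 :> R[i]) // scale1r => ev.
pose g := x - v; have g0 : g = 0.
  apply: nrm_eq0; apply/eqP; rewrite -sqrf_eq0 -rdotxx eq_le.
  rewrite {2}rdotxx sqr_ge0 andbT.
  have -> : rdot g g = rdot (z - A v) g.
    by congr rdot; rewrite /g -[x in LHS](subrK z) -ev; vring.
  apply: le_eps => e e0; rewrite add0r.
  have k0 : 0 < nrm g + 1 by rewrite ltr_wpDl ?nrm_ge0.
  have e2 : 0 < e / (nrm g + 1) / 2 by rewrite !divr_gt0.
  have [d d0 hd] := hz _ e2; have [d' d'0 hd'] := quotient_cvg dv e2.
  pose h := Num.min d d' / 2.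
  have m0 : 0 < Num.min d d' by rewrite lt_min d0.
  have h0 : 0 < h by rewrite divr_gt0.
  have hm : h < Num.min d d' by rewrite /h; lra.
  have hh1 : h < d by rewrite (lt_le_trans hm) // ge_min lexx.
  have hh2 : h < d' by rewrite (lt_le_trans hm) // ge_min lexx orbT.
  have h1 := hd h h0 hh1; have h2 := hd' h h0 hh2.
  set q := h^-1%:C%C *: (T h x - x) - z in h1.
  set q' := h^-1%:C%C *: (T h v - v) - A v in h2.
  have -> : z - A v = h^-1%:C%C *: (T h g - g) + (q' - q).
    by rewrite /g /q /q' semigroupB; vring.
  rewrite rdotDl -[leRHS]add0r lerD ?quotient_dissipative //.
  rewrite (le_trans (rdot_le _ _)) //.
  have h3 : nrm (q' - q) < e / (nrm g + 1).
    by rewrite (le_lt_trans (nrmD _ _)) // nrmN [ltRHS]splitr ltrD.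
  apply: (@le_trans _ _ (nrm (q' - q) * (nrm g + 1))).
    by rewrite ler_wpM2l ?nrm_ge0 // lerDl.
  by rewrite -ler_pdivlMr // ltW.
have xv : x = v by apply/subr0_eq.
split; first by rewrite xv.
by rewrite xv; apply/oppr_inj/(addrI v); rewrite ev xv.
Qed.

(** The Hilbert space case of the Hille-Yosida and Lumer-Phillips theorem. *)
Theorem m_dissipative_generates : generates_c0 A.
Proof.
have /choice[S hS] t : exists g : {linear X -> X}, g =1 T t.
  exact/linear_exists/semigroup_linear.
exists S; split.
  split.
  - move=> t _; apply: (@bound_continuous _ _ _ _ 1) => x.
    by rewrite mul1r hS semigroup_contr.
  - by move=> x; rewrite hS semigroup0.
  - by move=> s t x s0 t0; rewrite !hS semigroupD.
  - move=> x; apply/cvg_at_rightP => e e0.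
    have [d d0 hd] := semigroup_strong x e0; exists d => // h h0 hlt.
    by rewrite hS hd.
move=> x z; split=> [[dx <-]|/cvg_at_rightP hz].
  apply/cvg_at_rightP => e e0; have [d d0 hd] := quotient_cvg dx e0.
  by exists d => // h h0 hlt; rewrite hS hd.
apply: quotient_dom => e e0; have [d d0 hd] := hz e e0.
by exists d => // h h0 hlt; rewrite -hS hd.
Qed.

End HilleYosidaGeneration.

(** * Resolvents and invariant subspaces *)

Section Resolvent.
Variables (R : realType) (X : hilbertType R) (A : linop X X).
Implicit Types (x y : X) (mu al ga : R[i]).

Lemma resP mu : res A mu -> exists Q : {linear X -> X},
  [/\ continuous Q, Q =1 resolvent A mu,
      forall x, op_dom A (Q x) /\ mu *: Q x - A (Q x) = x
    & forall x, op_dom A x -> Q (mu *: x - A x) = x].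
Proof.
move=> [Q [cQ hQ kQ]]; exists Q; split=> // x.
have [dz ez] := getPex (ex_intro [set z | op_dom A z /\ mu *: z - A z = x] _ (hQ x)).
by rewrite -{1}ez kQ.
Qed.

Lemma resolventP mu x : res A mu ->
  op_dom A (resolvent A mu x) /\
  mu *: resolvent A mu x - A (resolvent A mu x) = x.
Proof. by case/resP => Q [_ QE hQ _]; rewrite -QE. Qed.

Lemma resolventK mu x : res A mu -> op_dom A x ->
  resolvent A mu (mu *: x - A x) = x.
Proof. by case/resP => Q [_ QE _ kQ] dx; rewrite -QE kQ. Qed.

Lemma resolvent_linear mu : res A mu -> linear (resolvent A mu).
Proof. by case/resP => Q [_ QE _ _] a x y; rewrite -!QE linearP. Qed.

Lemma resolventB mu x y : res A mu ->
  resolvent A mu (x - y) = resolvent A mu x - resolvent A mu y.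
Proof. by case/resP => Q [_ QE _ _]; rewrite -!QE raddfB. Qed.

Lemma resolvent_bound mu : res A mu -> exists2 k : R, 0 < k &
  forall x, nrm (resolvent A mu x) <= k * nrm x.
Proof.
case/resP => Q [cQ QE _ _]; have [k k0 kQ] := linear_bound cQ.
by exists k => // x; rewrite -QE.
Qed.

Lemma resolvent_unique mu x y : res A mu -> op_dom A x ->
  mu *: x - A x = y -> resolvent A mu y = x.
Proof. by move=> rmu dx <-; exact: resolventK. Qed.

Lemma res_eigen0 mu x : res A mu -> op_dom A x -> A x = mu *: x -> x = 0.
Proof.
move=> rmu dx e; rewrite -(resolventK rmu dx) e subrr.
by rewrite -(subrr 0) resolventB // !subrr.
Qed.

Lemma resolvent_shift al ga x : res A al -> res A ga ->
  resolvent A ga x = resolvent A al (x + (al - ga) *: resolvent A ga x).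
Proof.
move=> ra rg; have [dx ex] := resolventP x rg.
apply/esym/resolvent_unique => //.
by move: (resolvent A ga x) ex => z <-; vring.
Qed.

Lemma resolvent_near_bound al ga (k : R) : res A al -> res A ga ->
  (forall x, nrm (resolvent A al x) <= k * nrm x) ->
  k * cabs (al - ga) <= 1 / 2 -> 0 <= k ->
  forall x, nrm (resolvent A ga x) <= 2 * k * nrm x.
Proof.
move=> ra rg hk hc k0 x; have h := hk (x + (al - ga) *: resolvent A ga x).
rewrite -resolvent_shift // in h.
have := nrmD x ((al - ga) *: resolvent A ga x); rewrite nrmZ.
have := nrm_ge0 (resolvent A ga x); have := nrm_ge0 x.
have := cabs_ge0 (al - ga).
move: h hc; move: (nrm _) (nrm _) (cabs _) (nrm _) => p q c r h hc c0 r0 p0 hq.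
have := ler_wpM2l k0 hq; have := ler_wpM2r p0 hc.
by lra.
Qed.

(** The vector [w = (ga - A)^-1 m] is the fixed point of the contraction
    [v |-> (al - A)^-1 (m + (al - ga) v)], whose iterates from [0] stay in [M]. *)
Lemma resolvent_invariant_near (M : set X) al ga (k : R) :
  subspace M -> closed M -> res A al -> res A ga ->
  (forall x, nrm (resolvent A al x) <= k * nrm x) ->
  k * cabs (al - ga) <= 1 / 2 -> 0 <= k ->
  (forall m, M m -> M (resolvent A al m)) ->
  forall m, M m -> M (resolvent A ga m).
Proof.
move=> sM cM ra rg hk hc k0 aM m Mm.
set w := resolvent A ga m.
pose v n := iter n (fun v => resolvent A al (m + (al - ga) *: v)) 0.
have Mv n : M (v n).
  elim: n => [|n IHn]; first exact: subspace0.
  by apply: aM; apply: subspaceD => //; exact: subspaceZ.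
have vw n : nrm (w - v n) <= (2 ^ n)%:R^-1 * nrm w.
  elim: n => [|n IHn]; first by rewrite subr0 expn0 invr1 mul1r.
  rewrite [v _]/= {1}/w (resolvent_shift m ra rg) -resolventB //.
  rewrite opprD addrACA subrr add0r -scalerBr (le_trans (hk _)) // nrmZ mulrA.
  apply: (@le_trans _ _ (1 / 2 * nrm (w - v n))).
    by rewrite ler_wpM2r // nrm_ge0.
  rewrite expnS natrM invfM mul1r -mulrA.
  by rewrite ler_wpM2l // invr_ge0 ler0n.
move/closed_approxP: cM; apply=> e e0.
have c0 : 0 < nrm w + 1 by rewrite ltr_wpDl ?nrm_ge0.
have [N /(_ N (leqnn N)) hN] := inv_exp2_small (divr_gt0 e0 c0).
exists (v N) => //; apply: (le_lt_trans (vw N)).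
move: hN; rewrite ltr_pdivlMr //; apply: le_lt_trans.
by rewrite ler_wpM2l ?invr_ge0 ?ler0n // lerDl.
Qed.

End Resolvent.

Section ConnectedResolvent.
Variables (R : realType) (X : hilbertType R) (A : linop X X).

(** Analytic continuation in the form of an open-closed argument: the points
    of [C] at which [M] is invariant under the resolvent are relatively open
    and relatively closed, the radius of propagation around [mu] depending only
    on the norm of the resolvent at [mu]. *)
Lemma resolvent_invariant_connected (M : set X) (C : set R[i]^o) al ga :
  subspace M -> closed M -> connected C -> C `<=` res A -> C al -> C ga ->
  (forall m, M m -> M (resolvent A al m)) ->
  forall m, M m -> M (resolvent A ga m).
Proof.
move=> sM cM cC CA Cal Cga aM.
pose E : set R[i]^o := [set mu | forall m, M m -> M (resolvent A mu m)].
have loc mu : C mu -> exists2 r : R, 0 < r &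
    forall nu, C nu -> nrm (mu - nu : R[i]^o) < r -> (E mu <-> E nu).
  move=> Cmu; have rmu := CA _ Cmu; have [k k0 hk] := resolvent_bound rmu.
  (* nearby resolvents have norm at most 2 k, hence the factor 4 *)
  exists (1 / (4 * k)); first by rewrite divr_gt0 // mulr_gt0.
  move=> nu Cnu; rewrite ltr_pdivlMr ?mulr_gt0 // => hr.
  have {}hr : cabs (mu - nu) * (4 * k) < 1 by [].
  have rnu := CA _ Cnu.
  have c0 := cabs_ge0 (mu - nu).
  have hc : k * cabs (mu - nu) <= 1 / 2 by nra.
  split=> hE.
    exact: (resolvent_invariant_near sM cM rmu rnu hk hc (ltW k0) hE).
  have hk' := resolvent_near_bound rmu rnu hk hc (ltW k0).
  apply: (resolvent_invariant_near sM cM rnu rmu hk' _ _ hE); last by lra.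
  by rewrite -cabsN opprB; lra.
suff CE : C `&` E = C by have [_] : (C `&` E) ga by rewrite CE.
apply: cC; first by exists al.
- exists (\bigcup_(nu in C `&` E)
    [set la : R[i]^o | exists2 r : R, 0 < r & nrm (nu - la) < r /\
      forall nu', C nu' -> nrm (nu - nu' : R[i]^o) < r -> E nu']).
    apply: bigcup_open => nu _; rewrite openE => la [r r0 [h hE]].
    apply/nbhs_nrmP; exists (r - nrm (nu - la)); first by rewrite subr_gt0.
    move=> z hz; exists r => //; split=> //.
    by have := nrm_tri la nu z; lra.
  apply/seteqP; split=> [nu [Cnu Enu]|nu [Cnu [nu' _ [r r0 [h hE]]]]].
    split=> //; exists nu => //; have [r r0 hr] := loc _ Cnu.
    exists r => //; split; first by rewrite subrr nrm0.
    by move=> nu' Cnu' /(hr _ Cnu') <-.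
  by split=> //; exact: hE.
- exists (~` (\bigcup_(nu in C `\` E)
    [set la : R[i]^o | exists2 r : R, 0 < r & nrm (nu - la) < r /\
      forall nu', C nu' -> nrm (nu - nu' : R[i]^o) < r -> ~ E nu'])).
    rewrite closedC; apply: bigcup_open => nu _; rewrite openE => la [r r0 [h hE]].
    apply/nbhs_nrmP; exists (r - nrm (nu - la)); first by rewrite subr_gt0.
    move=> z hz; exists r => //; split=> //.
    by have := nrm_tri la nu z; lra.
  apply/seteqP; split=> [nu [Cnu Enu]|nu [Cnu nE]].
    by split=> // -[nu' _ [r r0 [h hE]]]; exact: hE Enu.
  split=> //; apply: contrapT => Enu; apply: nE; exists nu => //.
  have [r r0 hr] := loc _ Cnu; exists r => //; split; first by rewrite subrr nrm0.
  by move=> nu' Cnu' /(hr _ Cnu') <-.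
Qed.

End ConnectedResolvent.

(** * Energy balance and states of a system node *)

Section NodeOperators.
Variables (R : realType) (U X Y : hilbertType R).
Variable S : linop (X * U)%type (X * Y)%type.
Implicit Types (x z : X) (u v : U) (y : Y) (mu al be : R[i]).
Local Notation A := (main_op S).

(** [x = (mu - A)^-1 B u], expressed through the operator [S] alone. *)
Definition is_state mu u x := op_dom S (x, u) /\ (S (x, u)).1 = mu *: x.

Lemma node_domP a x u x' u' : op_dom S (x, u) -> op_dom S (x', u') ->
  op_dom S (a *: x + x', a *: u + u').
Proof. exact: (@linop_domP _ _ _ S a (x, u) (x', u')). Qed.

Lemma node_domB x u x' u' : op_dom S (x, u) -> op_dom S (x', u') ->
  op_dom S (x - x', u - u').
Proof. exact: (@linop_domB _ _ _ S (x, u) (x', u')). Qed.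

Lemma node_linear a x u x' u' : op_dom S (x, u) -> op_dom S (x', u') ->
  S (a *: x + x', a *: u + u') = a *: S (x, u) + S (x', u').
Proof. exact: (@op_linear _ _ _ S a (x, u) (x', u')). Qed.

Lemma node_sub x u x' u' : op_dom S (x, u) -> op_dom S (x', u') ->
  S (x - x', u - u') = S (x, u) - S (x', u').
Proof. exact: (@linopB _ _ _ S (x, u) (x', u')). Qed.

(** Subtracting a vector with the same input leaves the main operator. *)
Lemma node_sub_main x x' u : op_dom S (x, u) -> op_dom S (x', u) ->
  op_dom A (x - x') /\ S (x - x', 0) = S (x, u) - S (x', u).
Proof.
move=> d d'; have := node_domB d d'; have := node_sub d d'.
by rewrite subrr.
Qed.

Lemma node_add_main x x' u : op_dom A x -> op_dom S (x', u) ->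
  op_dom S (x + x', u) /\ S (x + x', u) = S (x, 0) + S (x', u).
Proof.
move=> d d'; have := node_domP 1 d d'; have := node_linear 1 d d'.
by rewrite !scale1r add0r.
Qed.

Lemma state_unique mu u x x' : res A mu -> is_state mu u x -> is_state mu u x' ->
  x = x'.
Proof.
move=> rmu [d e] [d' e']; have [dB eB] := node_sub_main d d'.
apply/subr0_eq/(res_eigen0 rmu dB).
by rewrite /= /main_op /= eB /= e e' scalerBr.
Qed.

(** The resolvent identity for states. *)
Lemma resolvent_states al be u x x' : res A al ->
  is_state al u x -> is_state be u x' ->
  (al - be) *: resolvent A al x' = x' - x.
Proof.
move=> ra [d e] [d' e']; have [dB eB] := node_sub_main d' d.
have <- : resolvent A al ((al - be) *: x') = (al - be) *: resolvent A al x'.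
  by case/resP: ra => Q [_ QE _ _]; rewrite -!QE linearZ.
apply: resolvent_unique => //=; rewrite /main_op /= eB /= e e'.
by vring.
Qed.

Section Energy.
Hypothesis energy : energy_preserving S.

Lemma energy_norm x u : op_dom S (x, u) ->
  2 * rdot (S (x, u)).1 x = nrm u ^+ 2 - nrm (S (x, u)).2 ^+ 2.
Proof.
move=> /energy /(congr1 (@complex.Re R)).
rewrite raddfD /= -/(rdot _ _) -/(rdot _ _) (rdotC x) => h.
rewrite mulr_natl mulr2n h raddfB /= -!hdot_norm -/(rdot _ _) -/(rdot _ _).
by rewrite !rdotxx.
Qed.

(** The energy balance says that a sesquilinear form vanishes on the diagonal
    of a complex subspace; evaluating it at [p + q] and [i p + q] shows that it
    vanishes identically. *)
Lemma energy_polar x u x' u' : op_dom S (x, u) -> op_dom S (x', u') ->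
  '[(S (x, u)).1, x'] + '[x, (S (x', u')).1] =
  '[u, u'] - '[(S (x, u)).2, (S (x', u')).2].
Proof.
move=> d d'.
have E a := energy (node_domP a d d').
move: (E 1) (E 'i) (energy d) (energy d').
rewrite !node_linear // -!hdot_norm /= !dotE conjCi.
move: (S (x, u)) (S (x', u')) => [z y] [z' y'] /=.
move=> /eqP; rewrite -subr_eq0 => /eqP h1 /eqP; rewrite -subr_eq0 => /eqP h2.
move=> /eqP; rewrite -subr_eq0 => /eqP h3 /eqP; rewrite -subr_eq0 => /eqP h4.
apply/subr0_eq; set F := _ - _.
pose G := '[z', x] + '[x', z] - ('[u', u] - '[y', y]).
have lin3 (a b c f k : R[i]) : a = 0 -> b = 0 -> c = 0 ->
    f = a - k * b - c -> f = 0.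
  by move=> -> -> -> ->; rewrite mulr0 !subr0.
have e1 : F + G = 0.
  by apply: (lin3 _ _ _ _ 1 h1 h3 h4); rewrite /F /G rmorph1; ring.
have e2 : 'i * (F - G) = 0.
  by apply: (lin3 _ _ _ _ ('i * - 'i) h2 h3 h4); rewrite /F /G; ring.
move/eqP: e2; rewrite mulf_eq0 (negbTE (neq0Ci _)) /= subr_eq0 => /eqP FG.
move/eqP: e1; rewrite -FG -mulr2n mulrn_eq0 /= => /eqP; exact.
Qed.

Lemma energy_main x : op_dom A x -> 2 * rdot (A x) x = - nrm (S (x, 0)).2 ^+ 2.
Proof. by move=> dx; rewrite energy_norm // nrm0 expr0n /= sub0r. Qed.

Lemma energy_dissipative x : op_dom A x -> rdot (A x) x <= 0.
Proof. by move=> /energy_main; have := sqr_ge0 (nrm (S (x, 0)).2); lra. Qed.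

Lemma energy_bound mu x : op_dom A x ->
  complex.Re mu * nrm x <= nrm (mu *: x - A x).
Proof.
move=> dx; have [->|x0] := eqVneq x 0.
  by rewrite nrm0 mulr0 nrm_ge0.
have nx := nrm_gt0 x0.
rewrite -(ler_pM2r nx) (le_trans _ (rdot_le _ _)) // rdotDl rdotNl.
have -> : rdot (mu *: x) x = complex.Re mu * nrm x ^+ 2.
  rewrite /rdot dotZl dotxx; case: mu => a b /=; ring.
by have := energy_dissipative dx; rewrite expr2 mulrA; lra.
Qed.

Lemma energy_output_bound x : op_dom A x ->
  nrm (S (x, 0)).2 ^+ 2 <= 2 * (nrm (A x) * nrm x).
Proof.
move=> /energy_main; have := rdot_le (- A x) x; rewrite rdotNl nrmN; lra.
Qed.

(** Same argument as [dom_dense], from a single point of the resolvent set. *)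
Lemma energy_dom_dense mu : res A mu -> 0 < complex.Re mu -> dense (op_dom A).
Proof.
move=> rmu mu0; apply: subspace_dense.
  by split=> [|a x y]; [exact: op_dom0|exact: op_domP].
move=> w hw; have [dv ev] := resolventP w rmu; set v := resolvent A mu w in dv ev.
have v0 : v = 0.
  apply: nrm_eq0; apply/eqP; rewrite -sqrf_eq0; apply/eqP.
  have := congr1 (@complex.Re R) (hw _ dv); rewrite -/(rdot _ _) -ev.
  have -> : rdot v (mu *: v - A v) = complex.Re mu * nrm v ^+ 2 - rdot (A v) v.
    rewrite rdotDr rdotNr (rdotC v (A v)) /rdot dotZr dotxx; congr (_ - _).
    by case: (mu) => a b /=; ring.
  move=> /= h; have := energy_dissipative dv; have := sqr_ge0 (nrm v).
  move: h mu0; move: (nrm v ^+ 2) (rdot _ _) (complex.Re mu) => a b c h c0 a0 b0.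
  by apply/le_anti; rewrite a0 andbT -(pmulr_rle0 _ c0); lra.
by rewrite -ev v0 linop0 scaler0 subrr.
Qed.

End Energy.

Section States.
Variable N : system_node S.
Local Notation W := (sn_rig N).

Lemma rig_emb_inj x : rig_emb W x = 0 -> x = 0.
Proof.
move=> e; have h : resolvent A (rig_beta W) x = 0.
  by apply: normr0_eq0; rewrite -rig_emb_norm e normr0.
have [dx ex] := resolventP x (rig_beta_res W).
by rewrite -ex h linop0 scaler0 subrr.
Qed.

Lemma is_stateP mu u x :
  is_state mu u x <-> mu *: rig_emb W x - rig_ext W x = sn_control N u.
Proof.
split=> [[d e]|e].
  by rewrite -linearZ -e (sn_extends N d) addrC addKr.
have h : rig_ext W x + sn_control N u = rig_emb W (mu *: x).
  by rewrite -e linearZ addrC subrK.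
have d : op_dom S (x, u) by apply/(sn_domE N); exists (mu *: x).
split=> //; apply/subr0_eq/rig_emb_inj; rewrite linearB /= (sn_extends N d) h.
exact: subrr.
Qed.

(** The vector chosen through the rigging is the unique state of [S]. *)
Lemma input_stateE mu u x : res A mu -> is_state mu u x -> input_state N mu u = x.
Proof.
move=> rmu sx; apply: (state_unique rmu _ sx); apply/is_stateP.
apply: (getPex (P := [set x | mu *: rig_emb W x - rig_ext W x = sn_control N u])).
by exists x; apply/is_stateP.
Qed.

Section Dense.
Hypothesis dense_dom : dense (op_dom A).
Let be := rig_beta W.
(** The operator [be - A|_X] is isometric from [X] onto the rigged space: it
    is isometric on the dense domain of [A], and its closed range contains the
    dense image of [X]. *)
Let L x : W := be *: rig_emb W x - rig_ext W x.

Let L_sub x z : L x - L z = L (x - z).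
Proof.
by rewrite /L !linearB /= addrACA.
Qed.

Let L_bound : exists2 k : R, 0 <= k & forall x, nrm (L x) <= k * nrm x.
Proof.
have [k1 k10 hk1] : exists2 k : R, 0 < k & forall x, nrm (rig_emb W x) <= k * nrm x.
  have [k k0 hk] := resolvent_bound (rig_beta_res W); exists k => // x.
  by rewrite /nrm rig_emb_norm; exact: hk.
have [k2 k20 hk2] := linear_bound (@rig_ext_continuous _ _ _ W).
exists (cabs be * k1 + k2); first by rewrite addr_ge0 ?mulr_ge0 ?cabs_ge0 ?ltW.
move=> x; rewrite (le_trans (nrmD _ _)) // nrmN nrmZ mulrDl lerD //.
by rewrite -mulrA ler_wpM2l ?cabs_ge0.
Qed.

Let L_iso x : nrm (L x) = nrm x.
Proof.
have [k k0 hk] := L_bound; have k1 : 0 < k + 1 by rewrite ltr_wpDl.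
have key (e : R) : 0 < e -> `|nrm (L x) - nrm x| <= 0 + e.
  move=> e0; have [|y dy xy] := (dense_approxP _).1 dense_dom x (e / (k + 1)).
    by rewrite divr_gt0.
  have Ly : nrm (L y) = nrm y.
    rewrite /L rig_extE // -linearZ -raddfB /nrm rig_emb_norm resolventK //.
    exact: rig_beta_res.
  have h1 := nrm_tri (L y) (L x) 0; have h2 := nrm_tri (L x) (L y) 0.
  have h3 := nrm_tri y x 0; have h4 := nrm_tri x y 0.
  rewrite !subr0 L_sub Ly in h1 h2; rewrite !subr0 (nrmB y x) in h3 h4.
  rewrite (nrmB (L y)) L_sub in h2.
  have h5 := hk (x - y).
  move: xy; rewrite ltr_pdivlMr // => h6.
  by rewrite add0r ler_norml; apply/andP; split; lra.
by apply/subr0_eq/normr0_eq0/le_anti; rewrite normr_ge0 (le_eps key).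
Qed.

Let L_surj (v : W) : exists x, L x = v.
Proof.
have [k k0 hk] := L_bound.
pose P := [set p : W * X | L p.2 - p.1 = 0].
have cP : closed P.
  apply: (@closed_lip _ (W * X)%type _ (fun p : W * X => L p.2 - p.1) (k + 1) [set 0]).
    exact: closed_zero.
  move=> p q; rewrite opprD opprK addrACA L_sub mulrDl mul1r.
  rewrite (le_trans (nrmD _ _)) // lerD //.
    rewrite (le_trans (hk _)) // ler_wpM2l //; exact: (nrm_snd (p - q)).
  rewrite [- p.1 + _]addrC. rewrite (nrmB p q); exact: (nrm_fst (q - p)).
have cD : closed [set w | exists x, P (w, x)].
  apply: (graph_domain_closed (k := 1) (complete_nrm_complete (V := X)) cP).
  move=> w x w' x' /subr0_eq /= <- /subr0_eq /= <-.
  by rewrite L_sub L_iso mul1r.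
suff [x /subr0_eq /= <-] : exists x, P (v, x) by exists x.
move/closed_approxP: cD; apply=> e e0.
have [_ [y _ <-] ve] := (dense_approxP _).1 (@rig_emb_dense _ _ _ W) v e e0.
exists (rig_emb W y) => //.
have [dx ex] := resolventP y (rig_beta_res W).
exists (resolvent A be y); rewrite /P /= /L rig_extE // -linearZ -raddfB ex.
exact: subrr.
Qed.

(** For [mu = be] invert [L]; for other [mu] use
    [x_mu = x_be + (be - mu) (mu - A)^-1 x_be]. *)
Lemma state_exists mu u : res A mu -> exists x, is_state mu u x.
Proof.
move=> rmu; have [x ex] := L_surj (sn_control N u).
have [d e] : is_state be u x by apply/is_stateP.
have [dr er] := resolventP ((be - mu) *: x) rmu.
have [d' e'] := node_add_main dr d.
eexists; split; first exact: d'.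
rewrite e' /= e; move: er; rewrite /main_op /=.
set r := resolvent _ _ _ => er.
have -> : (S (r, 0)).1 = mu *: r - (be - mu) *: x by rewrite -er; vring.
by vring.
Qed.

End Dense.
End States.
End NodeOperators.

(** * Total families, isometries, and density of the states *)

Section Total.
Variables (R : realType).

(** The span is dense; phrased as an induction principle over closed
    subspaces. *)
Definition total (V : normedModType R[i]) I (a : I -> V) :=
  forall M : set V, subspace M -> closed M -> (forall i, M (a i)) -> forall x, M x.

Lemma zero_set_closed (V : normedModType R[i]) (l : V -> R[i]) (k : R) :
  (forall x y, cabs (l x - l y) <= k * nrm (x - y)) -> closed [set x | l x = 0].
Proof.
move=> lk; apply: (@closed_lip _ V R[i]^o l k [set 0]) => //.
exact: closed_zero.
Qed.

Section Isometry.
Variables (V W : hilbertType R) (I : Type) (a : I -> V) (b : I -> W).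
Hypothesis gram : forall i j, '[a i, a j] = '[b i, b j].

Let G : set (V * W) := closed_span [set p | exists i, p = (a i, b i)].

Let defect (q p : V * W) := '[p.1, q.1] - '[p.2, q.2].

Let defect_closed q : subspace [set p | defect q p = 0] /\ closed [set p | defect q p = 0].
Proof.
have lin c p p' : defect q (c *: p + p') = c * defect q p + defect q p'.
  by rewrite /defect /= !dotE; ring.
split.
  split; first by rewrite /= /defect /= !dot0l subrr.
  by move=> c p p' /= hp hp'; rewrite lin hp hp' mulr0 addr0.
apply: (@zero_set_closed _ _ (nrm q.1 + nrm q.2)) => p p'.
have -> : defect q p - defect q p' = defect q (p - p').
  by rewrite /defect /= !dotE; ring.
rewrite (le_trans (cabsD _ _)) // cabsN mulrDl lerD //.
  rewrite (le_trans (cauchy_schwarz _ _)) // mulrC ler_wpM2l ?nrm_ge0 //.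
  exact: (nrm_fst (p - p')).
rewrite (le_trans (cauchy_schwarz _ _)) // mulrC ler_wpM2l ?nrm_ge0 //.
exact: (nrm_snd (p - p')).
Qed.

Let G_iso p q : G p -> G q -> '[p.1, q.1] = '[p.2, q.2].
Proof.
move=> Gp Gq; apply/subr0_eq.
have [sq cq] := defect_closed q; apply: (Gp _ sq cq) => _ [i ->].
have [si ci] := defect_closed (a i, b i).
have : defect (a i, b i) q = 0.
  by apply: (Gq _ si ci) => _ [j ->]; rewrite /= /defect /= gram subrr.
rewrite /= /defect /= => /subr0_eq h.
by rewrite (dotC (a i)) (dotC (b i)) h subrr.
Qed.

Let G_sub : subspace G. Proof. exact: closed_span_subspace. Qed.
Let G_closed : closed G. Proof. exact: closed_span_closed. Qed.

Let G_nrm x y x' y' : G (x, y) -> G (x', y') -> nrm (y - y') = nrm (x - x').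
Proof.
move=> h h'; have h2 := subspaceB G_sub h h'.
have := congr1 (@complex.Re R) (G_iso h2 h2); rewrite -!/(rdot _ _) !rdotxx /= => e.
by apply/eqP; rewrite -(@eqrXn2 _ 2) ?nrm_ge0 // e.
Qed.

(** Two total families with the same Gram matrix are unitarily equivalent. The
    unitary operator is the closed span of the pairs [(a i, b i)]: this relation
    is isometric, so its domain and range are closed. *)
Lemma isometric_extension : total a -> total b ->
  exists D : {linear V -> W}, unitary D /\ forall i, D (a i) = b i.
Proof.
move=> ta tb.
have dom x : exists y, G (x, y).
  apply: (ta [set x | exists y, G (x, y)]) => [||i].
  - split=> [|c x1 x2 [y1 h1] [y2 h2]]; first by exists 0; exact: subspace0 G_sub.
    by exists (c *: y1 + y2); exact: (subspaceP G_sub c h1 h2).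
  - apply: (graph_domain_closed (k := 1) (complete_nrm_complete (V := W)) G_closed).
    by move=> x1 y1 x2 y2 h1 h2; rewrite mul1r (G_nrm h1 h2).
  - by exists (b i); apply: sub_closed_span; exists i.
have rng y : exists x, G (x, y).
  have cG : closed [set p : W * V | G (p.2, p.1)].
    apply: (@closed_lip _ _ (V * W)%type (fun p : W * V => (p.2, p.1)) 1) => // p q.
    rewrite mul1r nrm_pair_le /=; apply/andP; split.
      exact: (nrm_snd (p - q)).
    exact: (nrm_fst (p - q)).
  apply: (tb [set y | exists x, G (x, y)]) => [||i].
  - split=> [|c x1 x2 [y1 h1] [y2 h2]]; first by exists 0; exact: subspace0 G_sub.
    by exists (c *: y1 + y2); exact: (subspaceP G_sub c h1 h2).
  - apply: (graph_domain_closed (k := 1) (complete_nrm_complete (V := V)) cG).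
    by move=> x1 y1 x2 y2 h1 h2; rewrite mul1r -(G_nrm h1 h2).
  - by exists (a i); apply: sub_closed_span; exists i.
have uniq x y y' : G (x, y) -> G (x, y') -> y = y'.
  by move=> h h'; apply/subr0_eq/nrm_eq0; rewrite (G_nrm h h') subrr nrm0.
have [d hd] := choice dom.
have [D DE] : exists g : {linear V -> W}, g =1 d.
  apply: linear_exists => c x y; apply: (uniq (c *: x + y)) => //.
  exact: (subspaceP G_sub c (hd x) (hd y)).
exists D; split; last first.
  by move=> i; rewrite DE; apply: (uniq (a i)) => //; apply: sub_closed_span; exists i.
split=> [f g|]; first by rewrite !DE -(G_iso (hd f) (hd g)).
apply/seteqP; split=> // y _; have [x hx] := rng y.
by exists x => //; rewrite DE; exact: uniq hx.
Qed.

End Isometry.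
End Total.

Section ControllableStates.
Variables (R : realType) (U X Y : hilbertType R).
Variables (S : linop (X * U)%type (X * Y)%type) (N : system_node S).
Local Notation A := (main_op S).
Local Notation st := (input_state N).

Hypothesis st_state : forall mu u, res A mu -> is_state S mu u (st mu u).

(** Controllability involves all states over the component of the resolvent
    set at [+oo], but those over any right half-plane already span: their closed
    span is invariant under the resolvents in the half-plane, hence by
    connectedness under all resolvents of the component, and these generate
    the remaining states. *)
Lemma states_total (w : R) : controllable N -> rhp w `<=` res A ->
  total (fun p : {mu | rhp w mu} * U => st (sval p.1) p.2).
Proof.
move=> cN wA M sM cM hM.
have {}hM mu u : rhp w mu -> M (st mu u).
  by move=> h; exact: (hM (exist _ mu h, u)).
pose M' := closed_span [set x | exists mu u, rhp w mu /\ x = st mu u].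
have sM' : subspace M' by exact: closed_span_subspace.
have cM' : closed M' by exact: closed_span_closed.
have stM' mu u : rhp w mu -> M' (st mu u).
  by move=> h; apply: sub_closed_span; exists mu, u.
(* the resolvent identity expresses resolvents of states by states *)
have inv al : rhp w al -> forall m, M' m -> M' (resolvent A al m).
  move=> wal m Mm; have ral := wA _ wal.
  have [k k0 hk] := resolvent_bound ral.
  have far be u : rhp w be -> al != be -> M' (resolvent A al (st be u)).
    move=> wbe ab; have rbe := wA _ wbe.
    have h := resolvent_states ral (st_state u ral) (st_state u rbe).
    have -> : resolvent A al (st be u) = (al - be)^-1 *: (st be u - st al u).
      by rewrite -h scalerA mulVf ?scale1r // subr_eq0.
    by apply: (subspaceZ sM'); apply: (subspaceB sM'); exact: stM'.
  apply: (Mm [set m | M' (resolvent A al m)]).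
  - split=> [|a x y hx hy] /=.
      rewrite (_ : resolvent A al 0 = 0); first exact: subspace0 sM'.
      by rewrite -(subrr 0) resolventB // !subrr.
    by rewrite (resolvent_linear ral); exact: (subspaceP sM').
  - by apply: (@closed_lip _ _ _ _ k) => // x y; rewrite -resolventB.
  move=> _ [be [u [wbe ->]]] /=.
  have [<-|ab] := eqVneq al be; last exact: far.
  move/closed_approxP: (cM'); apply => e e0.
  (* the state at [al] is approximated by the states at [al + r], r > 0 *)
  pose n := nrm (resolvent A al (st al u)).
  have n0 : 0 < n + 1 by rewrite ltr_wpDl ?nrm_ge0.
  pose r := Num.min (1 / (2 * k)) (e / (2 * k) / (n + 1)).
  have r0 : 0 < r by rewrite lt_min !divr_gt0 // mulr_gt0.
  pose ga := al + r%:C%C.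
  have wga : rhp w ga.
    by rewrite /rhp /= /ga raddfD /=; rewrite /rhp /= in wal; lra.
  have rga := wA _ wga.
  have ag : al - ga = - r%:C%C by rewrite /ga opprD addrA subrr add0r.
  have cag : cabs (al - ga) = r by rewrite ag cabsN cabs_real gtr0_norm.
  have hkr : k * cabs (al - ga) <= 1 / 2.
    rewrite cag -ler_pdivlMl // (le_trans (_ : r <= 1 / (2 * k))) //.
      by rewrite ge_min lexx.
    by rewrite le_eqVlt; apply/orP; left; apply/eqP; field; rewrite gt_eqF.
  have hg := resolvent_near_bound ral rga hk hkr (ltW k0).
  exists (resolvent A ga (st al u)).
    have rg0 : ga - al != 0.
      by rewrite -oppr_eq0 opprB ag oppr_eq0 (inj_eq (@complexI R)) gt_eqF.
    have h := resolvent_states rga (st_state u rga) (st_state u ral).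
    have -> : resolvent A ga (st al u) = (ga - al)^-1 *: (st al u - st ga u).
      by rewrite -h scalerA mulVf ?scale1r.
    by apply: (subspaceZ sM'); apply: (subspaceB sM'); exact: stM'.
  have -> : resolvent A al (st al u) - resolvent A ga (st al u) =
    - ((al - ga) *: resolvent A ga (resolvent A al (st al u))).
    rewrite [X in X - _](resolvent_shift _ rga ral).
    have [Q [_ QE _ _]] := resP rga; rewrite -!QE raddfD linearZ /=.
    by rewrite addrAC subrr add0r linearZ /= scalerN -scaleNr opprB.
  rewrite nrmN nrmZ cag; have := hg (resolvent A al (st al u)).
  rewrite -/n => h.
  apply: (@le_lt_trans _ _ (r * (2 * k * n))); first by rewrite ler_wpM2l // ltW.
  have hr : r <= e / (2 * k) / (n + 1) by rewrite ge_min lexx orbT.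
  apply: (@le_lt_trans _ _ (e / (2 * k) / (n + 1) * (2 * k * n))).
    by rewrite ler_wpM2r // !mulr_ge0 ?nrm_ge0 // ltW.
  have -> : e / (2 * k) / (n + 1) * (2 * k * n) = e * (n / (n + 1)).
    by field; rewrite !gt_eqF.
  by rewrite gtr_pMr // ltr_pdivrMr // mul1r ltrDl.
have sub : M' `<=` M by move=> x; apply=> // _ [mu [u [h ->]]]; exact: hM.
move=> x; apply: sub.
apply: (lin_span_dense_sub cN sM' cM') => _ [mu [u [[w1 hw1] ->]]].
pose nu : R[i] := (Num.max w w1 + 1)%:C%C.
have nuw : rhp w nu by rewrite /rhp /= (@le_lt_trans _ _ (Num.max w w1)) ?le_max ?lexx // ltrDl.
have nuw1 : rhp w1 nu.
  by rewrite /rhp /= (@le_lt_trans _ _ (Num.max w w1)) ?le_max ?lexx ?orbT // ltrDl.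
pose C := connected_component (res A) mu.
have Cnu : C nu by exact: hw1.
have rmu : res A mu.
  apply: contrapT => /connected_component_out h.
  by move: Cnu; rewrite /C h.
have rnu := wA _ nuw.
have hmu : forall m, M' m -> M' (resolvent A mu m).
  apply: (resolvent_invariant_connected sM' cM' _ _ Cnu _ (inv _ nuw)).
  - exact: component_connected.
  - exact: connected_component_sub.
  - exact: connected_component_refl.
have h := resolvent_states rmu (st_state u rmu) (st_state u rnu).
have -> : st mu u = st nu u - (mu - nu) *: resolvent A mu (st nu u).
  by rewrite h opprB addrC subrK.
apply: (subspaceB sM'); first exact: stM'.
by apply: (subspaceZ sM'); apply: hmu; exact: stM'.
Qed.

End ControllableStates.

(** * Uniqueness up to unitary equivalence *)

Section TotalEq.
Variables (R : realType) (V W : normedModType R[i]) (I : Type) (a : I -> V).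

Lemma total_eq (f g : V -> W) (k l : R) : total a -> linear f -> linear g ->
  (forall x, nrm (f x) <= k * nrm x) -> (forall x, nrm (g x) <= l * nrm x) ->
  (forall i, f (a i) = g (a i)) -> f =1 g.
Proof.
move=> ta /linear_exists[F FE] /linear_exists[G GE] fk gl fg x.
apply/subr0_eq; rewrite -FE -GE; apply: (ta [set x | F x - G x = 0]) => [||i].
- split=> [|c y z hy hz] /=; first by rewrite !linear0 addr0.
  by rewrite !linearP addrACA -scalerDr hy hz scaler0 addr0.
- apply: (@closed_lip _ _ _ (fun x => F x - G x) (k + l) [set 0]).
    exact: closed_zero.
  move=> y z; rewrite opprD addrACA -opprD -!linearB /= FE GE.
  by rewrite (le_trans (nrmD _ _)) // nrmN mulrDl lerD.
- by rewrite /= FE GE fg subrr.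
Qed.

End TotalEq.

Section NodeDecomposition.
Variables (R : realType) (U X Y : hilbertType R).
Variables (S : linop (X * U)%type (X * Y)%type) (N : system_node S).
Local Notation A := (main_op S).
Local Notation st := (input_state N).
Hypothesis energy : energy_preserving S.

(** Energy preservation makes the main operator densely defined, so that the
    states exist. *)
Lemma input_state_is mu0 : res A mu0 -> 0 < complex.Re mu0 ->
  forall mu u, res A mu -> is_state S mu u (st mu u).
Proof.
move=> r0 p0 mu u rmu.
have [x sx] := state_exists N (energy_dom_dense energy r0 p0) u rmu.
by rewrite (input_stateE N rmu sx).
Qed.

Variable al : R[i].
Hypothesis ral : res A al.
Hypothesis st_state : forall mu u, res A mu -> is_state S mu u (st mu u).

Definition out (f : X) : Y := (S (resolvent A al f, 0)).2.

Lemma out_linear : linear out.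
Proof.
move=> a f g; rewrite /out (resolvent_linear ral).
have [df _] := resolventP f ral; have [dg _] := resolventP g ral.
have := node_linear a df dg; rewrite scaler0 addr0 => ->.
by [].
Qed.

(** By energy preservation [|C x|^2 = -2 Re <A x, x>], which bounds
    [C (al - A)^-1]. *)
Lemma out_bound : exists k : R, forall f, nrm (out f) <= k * nrm f.
Proof.
have [k k0 hk] := resolvent_bound ral.
pose K := 2 * ((cabs al * k + 1) * k) + 1.
have c0 : 0 <= (cabs al * k + 1) * k.
  by rewrite mulr_ge0 ?addr_ge0 ?mulr_ge0 ?cabs_ge0 // ltW.
exists K => f; have [dr er] := resolventP f ral.
have K1 : 1 <= K by rewrite /K; lra.
rewrite -(@ler_pXn2r _ 2) ?nnegrE ?mulr_ge0 ?nrm_ge0 //; last by lra.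
rewrite (le_trans (energy_output_bound energy dr)) //.
set r := resolvent A al f in dr er *.
have eA : A r = al *: r - f by rewrite -er opprB addrC subrK.
have hA : nrm (A r) <= (cabs al * k + 1) * nrm f.
  rewrite eA (le_trans (nrmD _ _)) // nrmN nrmZ mulrDl mul1r lerD //.
  by rewrite -mulrA ler_wpM2l ?cabs_ge0 // hk.
apply: (@le_trans _ _ (2 * ((cabs al * k + 1) * nrm f * (k * nrm f)))).
  by rewrite ler_wpM2l // ler_pM ?nrm_ge0 // hk.
have -> : 2 * ((cabs al * k + 1) * nrm f * (k * nrm f)) = (K - 1) * nrm f ^+ 2.
  by rewrite /K; ring.
rewrite exprMn ler_wpM2r ?sqr_ge0 //; nra.
Qed.

(** The next two lemmas express [S] through the bounded data [resolvent A al],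
    [st al] and [out]; intertwining these intertwines [S]. *)
Lemma node_decompose x u : op_dom S (x, u) ->
  exists f, x = resolvent A al f + st al u.
Proof.
move=> d; have [ds _] := st_state u ral; have [dB _] := node_sub_main d ds.
exists (al *: (x - st al u) - A (x - st al u)).
by rewrite resolventK // subrK.
Qed.

Lemma node_value f u : let x := resolvent A al f + st al u in
  op_dom S (x, u) /\
  S (x, u) = (al *: x - f, out f + (S (st al u, u)).2).
Proof.
have [ds es] := st_state u ral; have [dr er] := resolventP f ral.
have [d e] := node_add_main dr ds; split=> //.
rewrite e [LHS]surjective_pairing /= es; congr (_, _).
move: er; rewrite /main_op /= -/(resolvent A al f) => er.
by move: (resolvent A al f) er => r <-; vring.
Qed.

Lemma resolvent_state be u : res A be -> al != be ->
  resolvent A al (st be u) = (al - be)^-1 *: (st be u - st al u).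
Proof.
move=> rbe ab; rewrite -(resolvent_states ral (st_state u ral) (st_state u rbe)).
by rewrite scalerA mulVf ?scale1r // subr_eq0.
Qed.

Lemma out_state be u : res A be -> al != be ->
  out (st be u) = (al - be)^-1 *: ((S (st be u, u)).2 - (S (st al u, u)).2).
Proof.
move=> rbe ab; rewrite /out resolvent_state //.
have [d _] := st_state u ral; have [d' _] := st_state u rbe.
have [dB eB] := node_sub_main d' d.
have := @linopZ _ _ _ S (al - be)^-1 (st be u - st al u, 0) dB.
by rewrite /= -[(_ *: _)]/(_ *: _, _ *: _) scaler0 eB => ->.
Qed.

End NodeDecomposition.

Section Uniqueness.
Variables (R : realType) (U Y X1 X2 : hilbertType R).
Variables (S1 : linop (X1 * U)%type (X1 * Y)%type) (N1 : system_node S1).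
Variables (S2 : linop (X2 * U)%type (X2 * Y)%type) (N2 : system_node S2).
Variable w : R.
Hypotheses (w0 : 0 <= w) (res1 : rhp w `<=` res (main_op S1))
  (res2 : rhp w `<=` res (main_op S2)).
Hypotheses (en1 : energy_preserving S1) (en2 : energy_preserving S2).
Hypotheses (ct1 : controllable N1) (ct2 : controllable N2).
Hypothesis same : forall mu u, rhp w mu -> transfer N1 mu u = transfer N2 mu u.
Local Notation A1 := (main_op S1).
Local Notation A2 := (main_op S2).
Local Notation st1 := (input_state N1).
Local Notation st2 := (input_state N2).

Let al : R[i] := (w + 1)%:C%C.
Let wal : rhp w al. Proof. by rewrite /rhp /= ltrDl. Qed.
Let al0 : 0 < complex.Re al. Proof. by rewrite /= ltr_wpDl. Qed.
Let s1 := input_state_is N1 en1 (res1 wal) al0.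
Let s2 := input_state_is N2 en2 (res2 wal) al0.

Let Isum mu nu : rhp w mu -> rhp w nu -> mu + nu^* != 0.
Proof.
rewrite /rhp /= => hm hn; apply/eqP => /(congr1 (@complex.Re R)).
rewrite raddfD /= Re_conj => h.
have : 0 < complex.Re mu + complex.Re nu by rewrite addr_gt0 // (le_lt_trans w0).
by rewrite h ltxx.
Qed.

(** By the polarised energy balance, the Gram matrix of the states is
    [(<u, v> - <D(mu) u, D(nu) v>) / (mu + conj nu)], a function of the transfer
    function [D] alone. *)
Lemma states_gram mu nu u v : rhp w mu -> rhp w nu ->
  '[st1 mu u, st1 nu v] = '[st2 mu u, st2 nu v].
Proof.
move=> hm hn; apply: (mulfI (Isum hm hn)).
have [d1 e1] := s1 u (res1 hm); have [d1' e1'] := s1 v (res1 hn).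
have [d2 e2] := s2 u (res2 hm); have [d2' e2'] := s2 v (res2 hn).
have := energy_polar en1 d1 d1'; have := energy_polar en2 d2 d2'.
rewrite e1 e1' e2 e2' !dotE.
have := same u hm; have := same v hn; rewrite /transfer => -> ->.
by rewrite !mulrDl => -> ->.
Qed.

(** The states over a half-plane determine the unitary operator. It intertwines
    the resolvents and the output operators at [al], because on states these are
    given by the resolvent identity and the transfer function; the identities
    are tested on the states over [Re > Re al], which avoid the point [al]. *)
Theorem nodes_similar : exists D : {linear X1 -> X2},
  unitary D /\
  set_bij (op_dom S1) (op_dom S2) (fun p => (D p.1, p.2)) /\
  (forall p, op_dom S1 p -> (D (S1 p).1, (S1 p).2) = S2 (D p.1, p.2)).
Proof.
pose w' := w + 1.
have sub : rhp w' `<=` rhp w by move=> mu; rewrite /rhp /= /w'; lra.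
have t1 := states_total s1 ct1 res1; have t2 := states_total s2 ct2 res2.
have [D [uD Dst]] := isometric_extension
  (fun i j => states_gram i.2 j.2 (svalP i.1) (svalP j.1)) t1 t2.
have {}Dst mu u : rhp w mu -> D (st1 mu u) = st2 mu u.
  by move=> h; exact: (Dst (exist _ mu h, u)).
have Dnrm x : nrm (D x) = nrm x.
  apply/eqP; rewrite -(@eqrXn2 _ 2) ?nrm_ge0 // -!rdotxx /rdot.
  by case: uD => ->.
have t1' := states_total s1 ct1 (subset_trans sub res1).
have ra1 := res1 wal; have ra2 := res2 wal.
have ne be : rhp w' be -> al != be.
  by rewrite /rhp /= /w' => h; apply/eqP => e; move: h; rewrite -e /= ltxx.
have [k1 k10 hk1] := resolvent_bound ra1.
have [k2 k20 hk2] := resolvent_bound ra2.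
have DR f : D (resolvent A1 al f) = resolvent A2 al (D f).
  move: f; apply: (total_eq (k := k1) (l := k2) t1').
  - by move=> a f g; rewrite (resolvent_linear ra1) linearP.
  - by move=> a f g; rewrite linearP (resolvent_linear ra2).
  - by move=> f; rewrite Dnrm.
  - by move=> f; rewrite -(Dnrm f).
  move=> [[be hbe] u] /=; have hb := sub _ hbe.
  rewrite Dst // !resolvent_state //; try exact: ne; try exact: res1; try exact: res2.
  by rewrite linearZ linearB /= !Dst.
have Dout f : out S1 al f = out S2 al (D f).
  have [l1 hl1] := out_bound en1 ra1; have [l2 hl2] := out_bound en2 ra2.
  move: f; apply: (total_eq (k := l1) (l := l2) t1').
  - exact: out_linear.
  - by move=> a f g; rewrite linearP (out_linear ra2).
  - by [].
  - by move=> f; rewrite -(Dnrm f).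
  move=> [[be hbe] u] /=; have hb := sub _ hbe.
  rewrite Dst // (out_state ra1 s1) ?(out_state ra2 s2) //; try exact: ne; try exact: res1; try exact: res2.
  by have := same u hb; have := same u wal; rewrite /transfer => -> ->.
have key f u : (D (resolvent A1 al f + st1 al u)) = resolvent A2 al (D f) + st2 al u.
  by rewrite linearD /= DR Dst.
have Dinj x y : D x = D y -> x = y.
  by move=> h; apply/subr0_eq/nrm_eq0; rewrite -Dnrm linearB /= h subrr nrm0.
exists D; split=> //; split.
  split.
  - move=> [x u] /= d; have [f ->] := node_decompose ra1 s1 d.
    by rewrite key; case: (node_value ra2 s2 (D f) u).
  - by move=> [x u] [x' u'] _ _ [/Dinj -> ->].
  - move=> [y u] d; have [g ->] := node_decompose ra2 s2 d.
    have [f _ <-] : range D g by case: uD => _ ->.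
    exists (resolvent A1 al f + st1 al u, u); last by rewrite /= key.
    by case: (node_value ra1 s1 f u).
move=> [x u] /= d; have [f ->] := node_decompose ra1 s1 d.
have [_ ->] := node_value ra1 s1 f u.
rewrite key; have [_ ->] := node_value ra2 s2 (D f) u.
rewrite /= -key linearB linearZ /= Dout; congr (_, _ + _).
exact: same.
Qed.

End Uniqueness.

(** * Building a system node from its states *)

Section NodeConstruction.
Variables (R : realType) (U X Y : hilbertType R).
Variable S : linop (X * U)%type (X * Y)%type.
Hypothesis energy : energy_preserving S.
Local Notation A := (main_op S).

(** The dissipative estimate makes [al - A] injective with bounded inverse. *)
Lemma range_res al : 0 < complex.Re al ->
  (forall w, exists x, op_dom A x /\ al *: x - A x = w) -> res A al.
Proof.
move=> al0 /choice[q hq].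
have uniq x x' w : op_dom A x -> op_dom A x' ->
    al *: x - A x = w -> al *: x' - A x' = w -> x = x'.
  move=> dx dx' ex ex'; apply/subr0_eq/nrm_eq0/le_anti; rewrite nrm_ge0 andbT.
  rewrite -(pmulr_rle0 _ al0).
  rewrite (le_trans (energy_bound energy al (linop_domB dx dx'))) //.
  rewrite linopB // (_ : _ - _ = (al *: x - A x) - (al *: x' - A x')).
    by rewrite ex ex' subrr nrm0.
  by vring.
have [Q QE] : exists Q : {linear X -> X}, Q =1 q.
  apply: linear_exists => a x y.
  have [[dx ex] [dy ey]] := (hq x, hq y); have [d e] := hq (a *: x + y).
  apply: (uniq _ _ (a *: x + y)) => //; first exact: op_domP.
  by rewrite op_linear // -[in RHS]ex -[in RHS]ey; vring.
exists Q; split.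
- apply: (@bound_continuous _ _ _ _ (complex.Re al)^-1) => x.
  have [d e] := hq x; rewrite QE ler_pdivlMl //.
  by rewrite -[in leRHS]e; exact: energy_bound.
- by move=> x; rewrite QE; exact: hq.
- by move=> x dx; rewrite QE; have [d e] := hq (al *: x - A x); exact: uniq e _.
Qed.

Lemma energy_generates : (forall r : R, 0 < r -> res A r%:C%C) -> generates_c0 A.
Proof.
move=> hres; apply: m_dissipative_generates.
  exact: energy_dissipative.
move=> h y h0; have hi : 0 < h^-1 by rewrite invr_gt0.
have [d e] := resolventP (h^-1%:C%C *: y) (hres _ hi).
exists (resolvent A h^-1%:C%C (h^-1%:C%C *: y)); split=> //.
have hC : h%:C%C * h^-1%:C%C = 1 :> R[i] by rewrite -rmorphM /= mulfV ?gt_eqF.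
rewrite -[RHS]scale1r -hC -[RHS]scalerA -[in RHS]e scalerBr scalerA hC.
by rewrite scale1r.
Qed.

(** The extended operator [be - A|_X] maps [X] isometrically onto its rigged
    completion, so [X] itself can serve as the completion, embedded in itself
    by the resolvent [Q] at [be]. In this model [A|_X] is [be Q - 1], and the
    control operator is the state map [b], since [B u = (be - A|_X) (b u)]. *)
Lemma node_from_states be (b : U -> X) (k : R) :
  closed_op S -> generates_c0 A -> res A be -> dense (op_dom A) -> linear b ->
  (forall u, nrm (b u) <= k * nrm u) -> (forall u, is_state S be u (b u)) ->
  inhabited (system_node S).
Proof.
move=> cS gA rbe dA /linear_exists[B BE] bk bs.
have [Q [cQ QE hQ kQ]] := resP rbe.
have [E EE] : exists E : {linear X -> X}, E =1 fun x => be *: Q x - x.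
  by apply: linear_exists => a x y; rewrite linearP; vring.
have cE : continuous E.
  have [l l0 hl] := linear_bound cQ.
  apply: (@bound_continuous _ _ _ _ (cabs be * l + 1)) => x.
  rewrite EE (le_trans (nrmD _ _)) // nrmN nrmZ mulrDl mul1r lerD //.
  by rewrite -mulrA ler_wpM2l ?cabs_ge0.
have Qd : dense (range Q).
  apply/dense_approxP => x e e0; have [y dy xy] := (dense_approxP _).1 dA x e e0.
  by exists y => //; exists (be *: y - A y) => //; exact: kQ.
have EA x : op_dom A x -> E x = Q (A x).
  move=> dx; rewrite EE -[x in _ - x](kQ x dx) linearB linearZ /=.
  by rewrite opprB addrC subrK.
pose W := @Rigging R X A be rbe X Q (fun x => congr1 _ (QE x)) Qd E cE EA.
have cB : continuous B.
  by apply: (@bound_continuous _ _ _ _ k) => u; rewrite BE.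
have ext x u : op_dom S (x, u) -> Q (S (x, u)).1 = E x + B u.
  move=> d; have [d' e'] := bs u; have [dB eB] := node_sub_main d d'.
  have := kQ _ dB; rewrite /main_op /= eB /= e' EE BE.
  set z := (S (x, u)).1 => h.
  have -> : b u = x - Q (be *: (x - b u) - (z - be *: b u)) by rewrite h; vring.
  rewrite (_ : be *: (x - b u) - (z - be *: b u) = be *: x - z); last by vring.
  by rewrite linearB linearZ /=; vring.
have domE x u : op_dom S (x, u) <-> range Q (E x + B u).
  split=> [d|[z _ ez]]; first by exists (S (x, u)).1 => //; exact: ext.
  have [d' _] := bs u; have [dq _] := hQ (be *: x - z).
  have -> : x = Q (be *: x - z) + b u.
    by rewrite linearB linearZ /= ez EE BE; vring.
  by case: (node_add_main dq d').
constructor; exact: (@SystemNode _ _ _ _ S cS gA W B cB ext domE).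
Qed.

End NodeConstruction.

Section HalfPlane.
Variable R : realType.

Lemma segment_connected_complex (al be : R[i]) :
  connected [set (al + t%:C%C * (be - al) : R[i]^o) | t in `[0 : R, 1]].
Proof.
apply: connected_continuous_connected; first exact: segment_connected.
apply: continuous_subspaceT => t P /nbhs_nrmP[e e0 eP].
have k0 : 0 < cabs (be - al) + 1 by rewrite ltr_wpDl ?cabs_ge0.
apply/nbhs_ballP; exists (e / (cabs (be - al) + 1)); first by rewrite /= divr_gt0.
move=> s; rewrite /ball /= ltr_pdivlMr // => hs; apply: eP.
have -> : al + t%:C%C * (be - al) - (al + s%:C%C * (be - al)) =
  (t - s)%:C%C * (be - al) by rewrite rmorphB; ring.
change (cabs ((t - s)%:C%C * (be - al)) < e).
rewrite cabsM cabs_real; apply: le_lt_trans hs.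
by rewrite ler_wpM2l // lerDl.
Qed.

(** A half-plane is star-shaped about each of its points. *)
Lemma rhp_component (B : set R[i]^o) (w : R) al : rhp w al -> rhp w `<=` B ->
  rhp w `<=` connected_component B al.
Proof.
move=> wal wB be wbe.
have h := @connected_component_max _ B
  [set (al + t%:C%C * (be - al) : R[i]^o) | t in `[0 : R, 1]] al.
apply: h; [|move|exact: segment_connected_complex|].
- by exists 0; rewrite ?mul0r ?addr0 //= in_itv /= lexx ler01.
- move=> _ [t t01 <-]; move: t01; rewrite /= in_itv /= => /andP[t0 t1]; apply: wB.
  move: wal wbe; rewrite /rhp /= => wal wbe.
  rewrite raddfD /= Re_realM raddfB /=.
  move: (complex.Re al) (complex.Re be) wal wbe => a b wa wb.
  have [ab|ba] := leP a b.
    by rewrite (lt_le_trans wa) // lerDl mulr_ge0 // subr_ge0.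
  have -> : a + t * (b - a) = b + (1 - t) * (a - b) by ring.
  by rewrite (lt_le_trans wb) // lerDl mulr_ge0 // subr_ge0 // ltW.
by exists 1; rewrite ?mul1r ?subrKC //= in_itv /= lexx ler01.
Qed.

End HalfPlane.

(** * The canonical model *)

Section CanonicalModel.
Variables (R : realType) (U Y : hilbertType R).
Variables (phi : R[i] -> {linear U -> Y}) (Hc : rkhs (Kc phi)).
Hypothesis contr : forall la, rhp 0 la -> forall u, nrm (phi la u) <= nrm u.
Implicit Types (al be mu : R[i]) (u v : U) (x z f : Hc) (y : Y).

Lemma rhp_conj mu : rhp 0 mu -> rhp 0 mu^*.
Proof. by rewrite /rhp /= Re_conj. Qed.

Lemma conj_sum_neq0 al be : rhp 0 al -> rhp 0 be -> al + be^* != 0.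
Proof.
rewrite /rhp /= => ha hb; apply/eqP => /(congr1 (@complex.Re R)).
rewrite raddfD /= Re_conj => h.
have : 0 < complex.Re al + complex.Re be by exact: addr_gt0.
by rewrite h ltxx.
Qed.

(** The kernel functions are indexed by the conjugate point, so that
    [kerf al u] turns out to be the state [(al - A)^-1 B u]. *)
Definition kerf al u : Hc :=
  get [set k : Hc | forall f : Hc, '[f, k] = '[rk_eval f al^*, u]].

Lemma kerf_dot al u f : rhp 0 al -> '[f, kerf al u] = '[rk_eval f al^*, u].
Proof.
move=> ha; have [k [_ hk]] := rk_kernel Hc u (rhp_conj ha).
have : exists k : Hc, forall f : Hc, '[f, k] = '[rk_eval f al^*, u] by exists k.
by move=> /getPex; exact.
Qed.

Lemma dot_extr (V : hilbertType R) (p q : V) :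
  (forall g, '[g, p] = '[g, q]) -> p = q.
Proof. by move=> h; apply: dot_ext => f; rewrite dotC h -dotC. Qed.

Lemma kerf_eval al u mu : rhp 0 al -> rhp 0 mu ->
  rk_eval (kerf al u) mu = Kc phi mu al^* u.
Proof.
move=> ha hm; have [k [hk1 hk]] := rk_kernel Hc u (rhp_conj ha).
have -> : kerf al u = k by apply: dot_extr => f; rewrite kerf_dot // hk.
exact: hk1.
Qed.

Lemma kerf_linear al : rhp 0 al -> linear (kerf al).
Proof.
by move=> ha a u v; apply: dot_extr => f; rewrite !dotE !kerf_dot // !dotE.
Qed.

Lemma phi_adjointP al y v : rhp 0 al ->
  '[adjoint (phi al) y, v] = '[y, phi al v].
Proof. by move=> ha; rewrite dotC adjointP -?dotC //; exact: contr. Qed.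

(** The reproducing property turns the kernel into the Gram matrix found in
    [states_gram]. *)
Lemma kerf_gram al be u v : rhp 0 al -> rhp 0 be ->
  (al + be^*) * '[kerf al u, kerf be v] = '[u, v] - '[phi al u, phi be v].
Proof.
move=> ha hb; rewrite kerf_dot // kerf_eval //; last exact: rhp_conj.
rewrite /Kc !conjCK !dotE phi_adjointP // mulrA (addrC be^*).
by rewrite divff ?mul1r // conj_sum_neq0.
Qed.

Lemma kerf_total x : (forall al u, rhp 0 al -> '[x, kerf al u] = 0) -> x = 0.
Proof.
move=> h; apply: rk_eval_inj => mu hm.
have e0 : rk_eval (0 : Hc) mu = 0.
  have := rk_eval_linear hm (-1) (0 : Hc) 0.
  by rewrite scaler0 addr0 scaleN1r addNr.
rewrite e0; apply: dot_ext => v; rewrite dot0l.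
have := h mu^* v (rhp_conj hm); rewrite kerf_dot ?conjCK //; exact: rhp_conj.
Qed.

Lemma kerf_norm al u : rhp 0 al ->
  2 * complex.Re al * nrm (kerf al u) ^+ 2 <= nrm u ^+ 2.
Proof.
move=> ha; have := congr1 (@complex.Re R) (kerf_gram u u ha ha).
rewrite dotxx raddfB /= -!/(rdot _ _) !rdotxx.
have -> (a : R[i]) (r : R) : complex.Re ((a + a^*) * r%:C%C) = 2 * complex.Re a * r.
  by case: a => p q; rewrite conjCE /=; ring.
by have := sqr_ge0 (nrm (phi al u)); lra.
Qed.

Lemma kerf_bound al u : rhp 0 al ->
  nrm (kerf al u) <= ((2 * complex.Re al)^-1 + 1) * nrm u.
Proof.
move=> ha; have a0 : 0 < 2 * complex.Re al by rewrite mulr_gt0.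
set c := (2 * _)^-1; have c0 : 0 < c by rewrite invr_gt0.
rewrite -(@ler_pXn2r _ 2) ?nnegrE ?mulr_ge0 ?nrm_ge0 //; last by lra.
apply: (@le_trans _ _ (c * nrm u ^+ 2)); first by rewrite ler_pdivlMl // kerf_norm.
rewrite exprMn ler_wpM2r ?sqr_ge0 //; nra.
Qed.

Definition graph_gen : set ((Hc * U) * (Hc * Y)) :=
  [set p | exists al u, rhp 0 al /\ p = ((kerf al u, u), (al *: kerf al u, phi al u))].

(** The least closed relation for which every [kerf al u] is a state with
    output [phi al u]. *)
Definition graph := closed_span graph_gen.

Lemma graph_sub : subspace graph. Proof. exact: closed_span_subspace. Qed.

Definition energy_form (p q : (Hc * U) * (Hc * Y)) :=
  '[p.2.1, q.1.1] + '[p.1.1, q.2.1] - ('[p.1.2, q.1.2] - '[p.2.2, q.2.2]).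

Lemma energy_form_zero_set q : subspace [set p | energy_form p q = 0] /\
  closed [set p | energy_form p q = 0].
Proof.
have lin c p p' : energy_form (c *: p + p') q = c * energy_form p q + energy_form p' q.
  by rewrite /energy_form /= !dotE; ring.
split.
  split; first by rewrite /= /energy_form /= !dot0l addr0 subrr subr0.
  by move=> c p p' /= hp hp'; rewrite lin hp hp' mulr0 addr0.
apply: (@zero_set_closed _ _ _ (nrm q.1.1 + nrm q.2.1 + (nrm q.1.2 + nrm q.2.2))) => p p'.
have -> : energy_form p q - energy_form p' q = energy_form (p - p') q.
  by rewrite /energy_form /= !dotE; ring.
move: (p - p') => {p p'} p; rewrite /energy_form.
have bd (V : hilbertType R) (a b : V) : nrm a <= nrm p ->
    cabs '[a, b] <= nrm b * nrm p.
  move=> ap; rewrite (le_trans (cauchy_schwarz _ _)) // mulrC.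
  by rewrite ler_wpM2l ?nrm_ge0.
rewrite (le_trans (cabsD _ _)) // cabsN mulrDl lerD //.
  rewrite (le_trans (cabsD _ _)) // mulrDl lerD // bd //.
    by rewrite (le_trans (nrm_fst p.2)) // nrm_snd.
  by rewrite (le_trans (nrm_fst p.1)) // nrm_fst.
rewrite (le_trans (cabsD _ _)) // cabsN mulrDl lerD // bd //.
  by rewrite (le_trans (nrm_snd p.1)) // nrm_fst.
by rewrite (le_trans (nrm_snd p.2)) // nrm_snd.
Qed.

Lemma energy_form_conj p q : energy_form p q = (energy_form q p)^*.
Proof.
rewrite /energy_form !rmorphB rmorphD /= -!dotC; congr (_ - _).
exact: addrC.
Qed.

(** On generators this is [kerf_gram]; it extends to the closed span one
    variable at a time. *)
Lemma graph_energy p q : graph p -> graph q -> energy_form p q = 0.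
Proof.
move=> gp gq; have [sq cq] := energy_form_zero_set q.
apply: (gp _ sq cq) => _ [al [u [ha ->]]].
rewrite /= energy_form_conj; set g := (_, _).
suff -> : energy_form q g = 0 by rewrite rmorph0.
have [sg cg] := energy_form_zero_set g.
apply: (gq _ sg cg) => _ [be [v [hb ->]]]; rewrite /g /energy_form /= !dotE.
by rewrite -mulrDl kerf_gram // subrr.
Qed.

Lemma graph_gen_in al u : rhp 0 al ->
  graph ((kerf al u, u), (al *: kerf al u, phi al u)).
Proof. by move=> ha; apply: sub_closed_span; exists al, u. Qed.

(** The energy balance of [((0, 0), (z, y))] with itself is [|y|^2 = 0], and
    its balance with the generators says that [z] vanishes at every point. *)
Lemma graph_single z y : graph ((0, 0), (z, y)) -> z = 0 /\ y = 0.
Proof.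
move=> h; have := graph_energy h h.
rewrite /energy_form /= !dot0l !dot0r !add0r opprK dotxx.
move=> /(congr1 (@complex.Re R)) /= /eqP; rewrite sqrf_eq0 => /eqP /nrm_eq0 y0.
split=> //; apply: kerf_total => al u ha.
have := graph_energy h (graph_gen_in u ha).
by rewrite /energy_form /= y0 !dot0l addr0 !subr0.
Qed.

Lemma graph_unique p q q' : graph (p, q) -> graph (p, q') -> q = q'.
Proof.
move=> h h'; have : graph (p - p, q - q') by exact: (subspaceB graph_sub h h').
rewrite subrr; case E: (q - q') => [z y].
move=> /graph_single[z0 y0]; apply/subr0_eq.
by rewrite E z0 y0.
Qed.

Definition canon_dom : set (Hc * U) := [set p | exists q, graph (p, q)].
Definition canon_fun (p : Hc * U) : Hc * Y := get [set q | graph (p, q)].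

Lemma canon_graph p : canon_dom p -> graph (p, canon_fun p).
Proof. by move=> h; exact: (getPex h). Qed.

Lemma canon_dom0 : canon_dom 0.
Proof. exists 0; exact: (subspace0 graph_sub). Qed.

Lemma canon_domP a p p' : canon_dom p -> canon_dom p' -> canon_dom (a *: p + p').
Proof.
move=> [q h] [q' h']; exists (a *: q + q').
exact: (subspaceP graph_sub a h h').
Qed.

Lemma canon_linear a p p' : canon_dom p -> canon_dom p' ->
  canon_fun (a *: p + p') = a *: canon_fun p + canon_fun p'.
Proof.
move=> h h'; apply: (@graph_unique (a *: p + p')).
  by apply: canon_graph; exact: canon_domP.
exact: (subspaceP graph_sub a (canon_graph h) (canon_graph h')).
Qed.

Definition canon : linop (Hc * U)%type (Hc * Y)%type :=
  Linop canon_dom0 canon_domP canon_linear.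

Local Notation Sc := canon.
Local Notation A := (main_op Sc).

Lemma canonP p q : graph (p, q) <-> op_dom Sc p /\ Sc p = q.
Proof.
split=> [h|[d <-]]; last exact: canon_graph.
have d : op_dom Sc p by exists q.
by split=> //; apply: graph_unique h; exact: canon_graph.
Qed.

Lemma canon_closed : closed_op Sc.
Proof.
rewrite /closed_op; have -> : [set p | op_dom Sc p.1 /\ Sc p.1 = p.2] = graph.
  by apply/seteqP; split=> -[p q] /canonP.
exact: closed_span_closed.
Qed.

Lemma canon_energy : energy_preserving Sc.
Proof.
move=> x u d; have g : graph ((x, u), Sc (x, u)) by apply/canonP.
by have /subr0_eq := graph_energy g g; rewrite /= -!hdot_norm.
Qed.

Lemma canon_state al u : rhp 0 al ->
  is_state Sc al u (kerf al u) /\ (Sc (kerf al u, u)).2 = phi al u.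
Proof. by move=> /(graph_gen_in u)/canonP[d e]; split; rewrite /is_state ?e. Qed.

(** This is the energy balance of [((x, u), Sc (x, u))] against the generators
    at [mu^*]: the reproducing property evaluates [Sc (x, u)] and [x] at [mu]. *)
Lemma canon_formula x u mu : op_dom Sc (x, u) -> rhp 0 mu ->
  rk_eval (Sc (x, u)).1 mu =
    - (mu *: rk_eval x mu) + u - adjoint (phi mu^*) (Sc (x, u)).2.
Proof.
move=> d hm; have g : graph ((x, u), Sc (x, u)) by apply/canonP.
have hm' := rhp_conj hm.
apply: dot_ext => v; have := graph_energy g (graph_gen_in v hm').
rewrite /energy_form /= !dotE !kerf_dot // conjCK phi_adjointP // => h.
apply/subr0_eq; rewrite -h; ring.
Qed.

Lemma canon_kerf_range al be u : rhp 0 al -> rhp 0 be -> al != be ->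
  op_dom A (kerf be u - kerf al u) /\
  al *: (kerf be u - kerf al u) - A (kerf be u - kerf al u) =
    (al - be) *: kerf be u.
Proof.
move=> ha hb ab; have [[d e] _] := canon_state u ha; have [[d' e'] _] := canon_state u hb.
have [dB eB] := node_sub_main d' d; split=> //.
have eA : A (kerf be u - kerf al u) =
    (Sc (kerf be u, u)).1 - (Sc (kerf al u, u)).1 := congr1 fst eB.
by rewrite eA e e'; vring.
Qed.

(** The range of [al - A] is closed, since the energy balance bounds both the
    state and the output, and it contains [kerf be u] for [be] other than [al]
    by the resolvent identity. The dissipative estimate also shows that
    [kerf be u] tends to [kerf al u] as [be] tends to [al], so the range is
    everything. *)
Lemma canon_range al w : rhp 0 al -> exists x, op_dom A x /\ al *: x - A x = w.
Proof.
move=> ha.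
pose h (p : Hc * (Hc * Y)) : (Hc * U) * (Hc * Y) :=
  ((p.2.1, 0), (al *: p.2.1 - p.1, p.2.2)).
pose P := [set p | graph (h p)].
have ca0 := cabs_ge0 al.
have sP : subspace P.
  split=> [|a p q hp hq]; rewrite /P /=.
    rewrite (_ : h 0 = 0); first exact: (subspace0 graph_sub).
    by rewrite /h /= scaler0 subrr.
  rewrite (_ : h _ = a *: h p + h q); first exact: (subspaceP graph_sub).
  rewrite /h /=; congr ((_, _), (_, _)).
    by rewrite -[RHS]/(a *: 0 + 0) scaler0 addr0.
  by vring.
have cP : closed P.
  apply: (@closed_lip _ (Hc * (Hc * Y))%type ((Hc * U) * (Hc * Y))%type h
    (cabs al + 2) graph (@closed_span_closed _ _ _)) => p q.
  rewrite (_ : h p - h q = h (p - q)); last first.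
    by rewrite /h; congr ((_, _), (_, _)); rewrite /= ?subrr //; vring.
  move: (p - q) => {p q} p; have n0 := nrm_ge0 p.
  have n1 := nrm_fst p; have n2 := nrm_snd p; have n3 := nrm_fst p.2.
  have n4 := nrm_snd p.2.
  have n5 := nrmD (al *: p.2.1) (- p.1); rewrite nrmN nrmZ in n5.
  have n6 : cabs al * nrm p.2.1 <= cabs al * nrm p.
    by rewrite ler_wpM2l // (le_trans n3).
  have n7 : 0 <= cabs al * nrm p by rewrite mulr_ge0.
  by rewrite !nrm_pair_le /= nrm0 !mulrDl; apply/andP; split; apply/andP; split; lra.
pose c := (complex.Re al)^-1; have c0 : 0 < c by rewrite invr_gt0.
pose K := 2 * ((cabs al * c + 1) * c) + 1 + c.
have q0 : 0 <= (cabs al * c + 1) * c.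
  by rewrite mulr_ge0 ?addr_ge0 ?mulr_ge0 // ltW.
have bd w' p : P (w', p) -> nrm p <= K * nrm w'.
  case: p => x y /canonP[] /= d e.
  have eA : A x = al *: x - w' := congr1 fst e.
  have ey : (Sc (x, 0)).2 = y := congr1 snd e.
  have hx : nrm x <= c * nrm w'.
    have := energy_bound canon_energy al (d : op_dom A x).
    by rewrite eA opprB addrC subrK /c ler_pdivlMl.
  have nw := nrm_ge0 w'.
  have K1 : 1 <= K by rewrite /K; lra.
  rewrite nrm_pair_le /=; apply/andP; split.
    by rewrite (le_trans hx) // ler_wpM2r // /K; lra.
  rewrite -(@ler_pXn2r _ 2) ?nnegrE ?mulr_ge0 ?nrm_ge0 //; last by lra.
  have := energy_output_bound canon_energy (d : op_dom A x); rewrite ey.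
  move=> h1; rewrite (le_trans h1) //.
  have hA : nrm (A x) <= (cabs al * c + 1) * nrm w'.
    rewrite eA (le_trans (nrmD _ _)) // nrmN nrmZ mulrDl mul1r lerD //.
    by rewrite -mulrA ler_wpM2l.
  apply: (@le_trans _ _ (2 * ((cabs al * c + 1) * nrm w' * (c * nrm w')))).
    by rewrite ler_wpM2l // ler_pM ?nrm_ge0.
  have -> : 2 * ((cabs al * c + 1) * nrm w' * (c * nrm w')) =
    (K - 1 - c) * nrm w' ^+ 2 by rewrite /K; ring.
  rewrite exprMn ler_wpM2r ?sqr_ge0 //; nra.
suff [[x y] /canonP[d e]] : exists p, P (w, p).
  have eA : A x = al *: x - w := congr1 fst e.
  by exists x; split=> //; rewrite eA; vring.
move: w; apply: closed_subspace_full.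
- split=> [|a w1 w2 [p1 h1] [p2 h2]]; first by exists 0; exact: (subspace0 sP).
  by exists (a *: p1 + p2); exact: (subspaceP sP a h1 h2).
- apply: (graph_domain_closed (k := K) _ cP).
    by apply: nrm_complete_prod; exact: complete_nrm_complete.
  move=> w1 p1 w2 p2 h1 h2; apply: bd.
  exact: (subspaceB sP h1 h2).
move=> w hw.
have far be u : rhp 0 be -> al != be -> '[kerf be u, w] = 0.
  move=> hb ab; apply: hw; have [d e] := canon_kerf_range u ha hb ab.
  pose x := (al - be)^-1 *: (kerf be u - kerf al u).
  have dx : op_dom A x by exact: linop_domZ.
  have ex : A x = al *: x - kerf be u.
    apply: (scalerI (_ : al - be != 0)); first by rewrite subr_eq0.
    rewrite scalerBr -e /x linopZ //.
    have ab0 : al - be != 0 by rewrite subr_eq0.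
    rewrite scalerA mulfV // scale1r; apply: dot_ext => f; rewrite !dotE.
    by field.
  exists (x, (Sc (x, 0)).2); apply/canonP; split=> //=.
  by rewrite [LHS]surjective_pairing -[(Sc (x, 0)).1]/(A x) ex.
apply: kerf_total => be u hb; rewrite dotC.
suff -> : '[kerf be u, w] = 0 by rewrite rmorph0.
have [<-|ab] := eqVneq al be; last exact: far.
(* approach al by al + r with r > 0, where the kernel bound at al still holds *)
apply: dot_approx => e e0.
pose n := ((2 * complex.Re al)^-1 + 1) * nrm u.
have n0 : 0 <= n.
  by rewrite mulr_ge0 ?nrm_ge0 // addr_ge0 // invr_ge0 mulr_ge0 // ltW.
have n1 : 0 < n + 1 by rewrite ltr_wpDl.
pose r := complex.Re al * e / (n + 1).
have r0 : 0 < r by rewrite divr_gt0 // mulr_gt0.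
pose ga := al + r%:C%C.
have Rga : complex.Re ga = complex.Re al + r by rewrite /ga raddfD.
have hg : rhp 0 ga by rewrite /rhp /= Rga addr_gt0.
have ag : al - ga = - r%:C%C by rewrite /ga opprD addrA subrr add0r.
have neq : al != ga.
  by rewrite -subr_eq0 ag oppr_eq0 (inj_eq (@complexI R)) gt_eqF.
exists (kerf ga u); first exact: far.
have [d' e'] := canon_kerf_range u ha hg neq.
have := energy_bound canon_energy al d'.
rewrite e' nrmZ ag cabsN cabs_real gtr0_norm // nrmB => h1.
have h2 : nrm (kerf ga u) <= n.
  rewrite (le_trans (kerf_bound u hg)) // ler_wpM2r ?nrm_ge0 // lerD2r.
  by rewrite lef_pV2 ?posrE ?mulr_gt0 // ler_pM2l // Rga lerDl ltW.
rewrite -(ltr_pM2l ha) (le_lt_trans h1) //.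
apply: (@le_lt_trans _ _ (r * n)); first by rewrite ler_wpM2l // ltW.
have -> : r * n = complex.Re al * e * (n / (n + 1)) by rewrite /r; field; rewrite gt_eqF.
by rewrite gtr_pMr ?mulr_gt0 // ltr_pdivrMr // mul1r ltrDl.
Qed.

Lemma canon_res : rhp 0 `<=` res A.
Proof.
move=> al ha; apply: (range_res canon_energy ha) => w; exact: canon_range.
Qed.

Lemma canon_node : inhabited (system_node Sc).
Proof.
have h1 : rhp 0 (1 : R[i]) by rewrite /rhp /= ltr01.
apply: (@node_from_states _ _ _ _ _ 1 (kerf 1) _ canon_closed _ (canon_res h1)).
- by apply: (energy_generates canon_energy) => r r0; apply: canon_res.
- exact: (energy_dom_dense canon_energy (canon_res h1)).
- exact: kerf_linear.
- by move=> u; exact: kerf_bound.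
- by move=> u; case: (canon_state u h1).
Qed.

Section Node.
Variable N : system_node Sc.

Lemma canon_input_state al u : rhp 0 al -> input_state N al u = kerf al u.
Proof.
move=> ha; apply: input_stateE; first exact: canon_res.
by case: (canon_state u ha).
Qed.

Lemma canon_transfer al u : rhp 0 al -> transfer N al u = phi al u.
Proof.
move=> ha; rewrite /transfer canon_input_state //.
by case: (canon_state u ha).
Qed.

Lemma canon_controllable : controllable N.
Proof.
apply: lin_span_dense => w hw; apply: kerf_total => al u ha.
rewrite dotC hw ?rmorph0 //; exists al, u; split; last by rewrite canon_input_state.
exists 0; exact: rhp_component ha canon_res.
Qed.

End Node.
End CanonicalModel.

Theorem theorem1p7 (R : realType) (U Y : hilbertType R)
    (sepU : separable U) (sepY : separable Y)
    (phi : R[i] -> {linear U -> Y}) (phi_schur : schur phi)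
    (Hc : rkhs (Kc phi)) :
  exists (Sc : linop (Hc * U)%type (Hc * Y)%type) (Nc : system_node Sc),
    (forall x u lambda, op_dom Sc (x, u) -> rhp 0 lambda ->
      exists! gamma : Y,
        (forall mu, rhp 0 mu ->
          rk_eval (Sc (x, u)).1 mu =
            - (mu *: rk_eval x mu) - adjoint (phi mu^*) gamma
            + (u - adjoint (phi mu^*) (phi lambda^* u))) /\
        (Sc (x, u)).2 = gamma + phi lambda^* u) /\
    (controllable Nc /\ energy_preserving Sc) /\
    realizes Nc phi /\
    (forall (X : hilbertType R) (S : linop (X * U)%type (X * Y)%type)
        (N : system_node S),
      controllable N -> energy_preserving S -> realizes N phi ->
      exists Delta : {linear Hc -> X},
        unitary Delta /\
        set_bij (op_dom Sc) (op_dom S) (fun p => (Delta p.1, p.2)) /\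
        (forall p, op_dom Sc p ->
          (Delta (Sc p).1, (Sc p).2) = S (Delta p.1, p.2))).
Proof.
have contr la : rhp 0 la -> forall u, nrm (phi la u) <= nrm u.
  by move=> h u; have [hc _] := phi_schur la h; rewrite -lecR !nrmE.
have [Nc] := canon_node Hc contr; exists (canon Hc contr), Nc.
have ct := canon_controllable Nc.
have en := @canon_energy _ _ _ _ Hc contr.
split; [|split; [by split|split]].
- move=> x u la d hla; exists ((canon Hc contr (x, u)).2 - phi la^* u).
  split; last by move=> y [_ ->]; rewrite addrK.
  split=> [mu hm|]; last by rewrite subrK.
  rewrite canon_formula //; apply: dot_ext => v.
  have hm' := rhp_conj hm.
  rewrite !dotE !(phi_adjointP contr) //.
  by rewrite dotDl dotNl; ring.
- exists 0; split=> [al ha|mu u hm]; last exact: canon_transfer.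
  by split=> //; exact: canon_res.
- move=> X S N ctS enS [w [hw hphi]].
  pose w' := Num.max 0 w.
  have sub0 : rhp w' `<=` rhp 0.
    by move=> mu; apply: le_lt_trans; rewrite le_max lexx.
  have subw : rhp w' `<=` rhp w.
    by move=> mu; apply: le_lt_trans; rewrite le_max lexx orbT.
  apply: (@nodes_similar _ _ _ _ _ _ Nc _ N w') => //.
  + by rewrite le_max lexx.
  + exact: subset_trans sub0 (@canon_res _ _ _ _ Hc contr).
  + by move=> mu /subw /hw [].
  + by move=> mu u hm; rewrite canon_transfer ?hphi //; [exact: subw|exact: sub0].
Qed.
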